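(* Let $a,b\in\mathbb{C}$ and let $M$ be a free conformal module of rank one over $CHV(a,b)$. (1) If $a\neq1$ or $b\neq0$, then $M\cong M'_{\alpha,\beta,c}$ for some $\alpha,\beta,c\in\mathbb{C}$. (2) If $a=1$ and $b=0$, then $M\cong M'_{\alpha,\beta,c,d}$ for some $\alpha,\beta,c,d\in\mathbb{C}$. Furthermore, $M'_{\alpha,\beta,c}$ and $M'_{\alpha,\beta,c,d}$ are irreducible if and only if $\alpha,c\neq0$ (that is, $\alpha\neq0$ and $c\neq0$).
   Context: A Lie conformal algebra is a $\mathbb{C}[\partial]$-module $R$ with a $\mathbb{C}$-linear map ($\lambda$-bracket) $R\otimes R\to R[\lambda]=\mathbb{C}[\lambda]\otimes R$, $x\otimes y\mapsto[x{}_\lambda y]$, satisfying $[\partial x{}_\lambda y]=-\lambda[x{}_\lambda y]$, $[x{}_\lambda\partial y]=(\partial+\lambda)[x{}_\lambda y]$, $[x{}_\lambda y]=-[y{}_{-\lambda-\partial}x]$ and $[x{}_\lambda[y{}_\mu z]]=[[x{}_\lambda y]{}_{\lambda+\mu}z]+[y{}_\mu[x{}_\lambda z]]$. For $a,b\in\mathbb{C}$, $CHV(a,b)$ is the Lie conformal algebra that is free over $\mathbb{C}[\partial]$ with basis $\{L_i,M_i\mid i\in\mathbb{Z}\}$ and $\lambda$-brackets $$[L_i{}_\lambda L_j]=(\partial+2\lambda)L_{i+j},\quad [L_i{}_\lambda M_j]=(\partial+a\lambda+b)M_{i+j},\quad[M_i{}_\lambda M_j]=0,$$ with $[M_i{}_\lambda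 L_j]$ determined by skew-symmetry. A conformal module $V$ over a Lie conformal algebra $R$ is a $\mathbb{C}[\partial]$-module with a $\mathbb{C}$-linear $\lambda$-action $R\otimes V\to V[\lambda]$, $x\otimes v\mapsto x{}_\lambda v$, such that $(\partial x){}_\lambda v=-\lambda\,x{}_\lambda v$, $x{}_\lambda(\partial v)=(\partial+\lambda)x{}_\lambda v$ and $x{}_\lambda(y{}_\mu v)-y{}_\mu(x{}_\lambda v)=[x{}_\lambda y]{}_{\lambda+\mu}v$ for all $x,y\in R$, $v\in V$. It is free of rank one if it is free of rank one as a $\mathbb{C}[\partial]$-module. For $\alpha,\beta,c\in\mathbb{C}$, $M'_{\alpha,\beta,c}=\mathbb{C}[\partial]v$ (free of rank one) with $$L_i{}_\lambda v=c^i(\partial+\alpha\lambda+\beta)v,\qquad M_i{}_\lambda v=0\qquad(i\in\mathbb{Z}).$$ For $a=1$, $b=0$ and $\alpha,\beta,c,d\in\mathbb{C}$, $M'_{\alpha,\beta,c,d}=\mathbb{C}[\partial]v$ (free of rank one), a module over $CHV(1,0)$, with $$L_i{}_\lambda v=c^i(\partial+\alpha\lambda+\beta)v,\qquad M_i{}_\lambda v=dc^iv\qquad(i\in\mathbb{Z}).$$ For $c=0$, $c^i$ is understood to be $0$ for every $i\in\mathbb{Z}$, so that the module is trivial (zero action) exactly when $c=0$.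
   Formalization: The claim that M'_{α,β,c,d} is irreducible iff α,c≠0 fails for α=0, c≠0, d≠0; it is replaced by the exact criterion c≠0 and (α≠0 or d≠0), plus: M'_{α,β,c} (over CHV(1,0)) and M'_{α,β,c,d} are both irreducible iff α,c≠0. *)

(* Defs.v *)
From HB Require Import structures.
From mathcomp Require Import all_boot all_order all_algebra.
From mathcomp Require Import finmap monalg ring.

Set Implicit Arguments.
Unset Strict Implicit.
Unset Printing Implicit Defensive.

Import GRing.Theory.
Local Open Scope ring_scope.

(** * Polynomials with coefficients in a module *)

(* [lampoly V] is V[lambda] = C[lambda] (x) V for a module [V] over a
   commutative ring [S]: finitely supported coefficient sequences, seen as a
   module over S[lambda] = [{poly S}].  Iterating gives V[lambda][mu], a module
   over S[lambda][mu] = [{poly {poly S}}].  (It is an alias because [malg]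
   carries another scalar action of its own.) *)
Definition lampoly (S : comNzRingType) (V : lmodType S) : Type := {malg V[nat]}.

HB.instance Definition _ (S : comNzRingType) (V : lmodType S) :=
  GRing.Zmodule.on (lampoly V).

Section LamPoly.
Variables (S : comNzRingType) (V : lmodType S).

Definition lcoef (i : nat) (f : lampoly V) : V := mcoeff i (f : {malg V[nat]}).
Definition lconst (v : V) : lampoly V := mkmalgU 0%N v.

Lemma lcoefP (f g : lampoly V) : (forall i, lcoef i f = lcoef i g) -> f = g.
Proof. by move=> h; apply/malgP. Qed.

Lemma lcoef_is_additive i : {morph lcoef i : f g / f - g}.
Proof. exact: mcoeffB. Qed.
HB.instance Definition _ i :=
  GRing.isZmodMorphism.Build (lampoly V) V (lcoef i) (lcoef_is_additive i).

Lemma lconst_is_additive : {morph lconst : u v / u - v}.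
Proof. exact: monalgUB. Qed.
HB.instance Definition _ :=
  GRing.isZmodMorphism.Build V (lampoly V) lconst lconst_is_additive.

Definition lscale (p : {poly S}) (f : lampoly V) : lampoly V :=
  \sum_(k <- msupp f) \sum_(i < size p)
     (<< p`_i *: lcoef k f *g (i + k)%N >> : {malg V[nat]}).

Lemma lcoef_lscale p f n :
  lcoef n (lscale p f) = \sum_(i < n.+1) p`_i *: lcoef (n - i) f.
Proof.
rewrite /lscale raddf_sum /=.
under eq_bigr => k _.
  rewrite raddf_sum /=.
  under eq_bigr => i _ do rewrite /lcoef mcoeffU -/(lcoef k f).
  over.
rewrite exchange_big /=.
have E (i : nat) : \sum_(k <- msupp f) (p`_i *: lcoef k f) *+ ((i + k)%N == n)
   = if (i <= n)%N then p`_i *: lcoef (n - i) f else 0.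
  case: leqP => [le_in|lt_ni]; last first.
    by rewrite big1 // => k _; rewrite gtn_eqF ?mulr0n // (leq_trans lt_ni) ?leq_addr.
  have eqk k : ((i + k)%N == n) = (k == n - i)%N.
    by rewrite -{1}(subnKC le_in) eqn_add2l.
  under eq_bigr => k _ do rewrite eqk.
  have [hin|h0] := boolP ((n - i)%N \in msupp f); last first.
    rewrite [in RHS]/lcoef mcoeff_outdom // scaler0 big_seq big1 // => k hk.
    by rewrite (_ : (k == _) = false) ?mulr0n //; apply: contraNF h0 => /eqP <-.
  rewrite (big_fsetD1 (n - i)%N) //= eqxx mulr1n big_seq big1 ?addr0 // => k.
  by rewrite !inE => /andP[/negbTE -> _]; rewrite mulr0n.
under eq_bigr => i _ do rewrite E.
rewrite -(big_mkord xpredT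
  (fun i => if (i <= n)%N then p`_i *: lcoef (n - i) f else 0)).
rewrite -(big_mkord xpredT (fun i => p`_i *: lcoef (n - i) f)).
rewrite (big_nat_widen _ _ (maxn (size p) n.+1)) ?leq_maxl //.
rewrite [RHS](big_nat_widen _ _ (maxn (size p) n.+1)) ?leq_maxr //.
rewrite [LHS]big_mkcond [RHS]big_mkcond /=; apply: eq_bigr => i _.
rewrite ltnS; case: (leqP i n) => [_|_]; last by rewrite if_same.
by case: ltnP => // h; rewrite nth_default // scale0r.
Qed.

Lemma lscaleA p q f : lscale p (lscale q f) = lscale (p * q) f.
Proof.
apply: lcoefP => n; rewrite !lcoef_lscale.
pose coef3 j i := p`_j *: (q`_(i - j) *: lcoef (n - i) f).
transitivity (\sum_(j < n.+1) \sum_(i < n.+1 | (j <= i)%N) coef3 j i).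
  apply: eq_bigr => j _; rewrite lcoef_lscale scaler_sumr.
  rewrite -[in RHS](big_mkord (fun i => (j <= i)%N) (coef3 j)).
  rewrite (big_cat_nat (n := j)) //=; last by rewrite ltnW // ltn_ord.
  rewrite [X in X + _]big_nat_cond [X in X + _]big1 ?add0r; last first.
    by move=> i /andP[/andP[_ h1] h2]; move: h1; rewrite ltnNge h2.
  have := big_addn 0 n.+1 j (fun i => (j <= i)%N) (coef3 j).
  rewrite add0n => ->; rewrite subSn -1?ltnS // big_mkord.
  apply: eq_big => [i|i _]; first by rewrite leq_addl.
  by rewrite /coef3 addnK addnC subnDA.
rewrite (exchange_big_dep predT) //=; apply: eq_bigr => i _.
rewrite coefM scaler_suml (big_ord_narrow_leq (leq_ord i)) /=.
by apply: eq_bigr => j _; rewrite /coef3 scalerA.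
Qed.

Lemma lscale1 : left_id 1 lscale.
Proof.
move=> f; apply: lcoefP => n; rewrite lcoef_lscale big_ord_recl /= coef1 scale1r.
by rewrite subn0 big1 ?addr0 // => i _; rewrite coef1 scale0r.
Qed.

Lemma lscaleDr : right_distributive lscale +%R.
Proof.
move=> p f g; apply: lcoefP => n; rewrite raddfD /= !lcoef_lscale -big_split /=.
by apply: eq_bigr => i _; rewrite raddfD scalerDr.
Qed.

Lemma lscaleDl f : {morph lscale^~ f : p q / p + q}.
Proof.
move=> p q; apply: lcoefP => n; rewrite raddfD /= !lcoef_lscale -big_split /=.
by apply: eq_bigr => i _; rewrite coefD scalerDl.
Qed.

HB.instance Definition _ := GRing.Zmodule_isLmodule.Build {poly S} (lampoly V)
  lscaleA lscale1 lscaleDr lscaleDl.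

Lemma lcoefZ p f n :
  lcoef n (p *: f) = \sum_(i < n.+1) p`_i *: lcoef (n - i) f.
Proof. exact: lcoef_lscale. Qed.

End LamPoly.

(* Substitution of a scalar [s] for the variable:
   sum_i v_i lambda^i |-> sum_i s^i *: iota (v_i). *)
Definition lsubst (S : comNzRingType) (V : lmodType S) (T : comNzRingType)
    (W : lmodType T) (iota : V -> W) (s : T) (f : lampoly V) : W :=
  \sum_(k <- msupp f) s ^+ k *: iota (lcoef k f).

(** * Lie conformal algebras and conformal modules *)

Section Conformal.
Variable K : fieldType.

(* A K[d]-module is an [lmodType {poly K}], the derivation d acting as ['X].
   On V[lambda], the scalar ['X] is lambda and ['X%:P] is d; on V[lambda][mu],
   d, lambda and mu are the following scalars. *)
Definition del2 : {poly {poly {poly K}}} := 'X%:P%:P.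
Definition lam2 : {poly {poly {poly K}}} := 'X%:P.
Definition mu2 : {poly {poly {poly K}}} := 'X.

(* K-bilinearity and conformal sesquilinearity of (x, v) |-> x_lambda v. *)
Record sesquilinear (R V : lmodType {poly K}) (act : R -> V -> lampoly V) :
    Prop := Sesquilinear {
  sesqDl : forall x y v, act (x + y) v = act x v + act y v;
  sesqDr : forall x v w, act x (v + w) = act x v + act x w;
  sesqCl : forall (c : K) x v, act (c%:P *: x) v = c%:P%:P *: act x v;
  sesqCr : forall (c : K) x v, act x (c%:P *: v) = c%:P%:P *: act x v;
  sesqXl : forall x v, act ('X *: x) v = - 'X *: act x v;
  sesqXr : forall x v, act x ('X *: v) = ('X%:P + 'X) *: act x v
}.

(* x_s v as an element of V[lambda][mu], e.g. for s = lambda + mu. *)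
Definition act_at (R V : lmodType {poly K}) (act : R -> V -> lampoly V)
    (s : {poly {poly {poly K}}}) (x : R) (v : V) : lampoly (lampoly V) :=
  lsubst (fun w => lconst (lconst w)) s (act x v).

(* x_lambda (y_mu v) - y_mu (x_lambda v) = [x_lambda y]_{lambda + mu} v
   in V[lambda][mu]. *)
Definition jacobi (R V : lmodType {poly K}) (br : R -> R -> lampoly R)
    (act : R -> V -> lampoly V) (x y : R) (v : V) : Prop :=
  lsubst (act_at act lam2 x) mu2 (act y v)
    - lsubst (act_at act mu2 y) lam2 (act x v)
  = lsubst (fun z => act_at act (lam2 + mu2) z v) lam2 (br x y).

(* [x_lambda y] = - [y_{- lambda - d} x] in R[lambda]. *)
Definition skew (R : lmodType {poly K}) (br : R -> R -> lampoly R) (x y : R) :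
    Prop :=
  br x y = - lsubst (@lconst _ R) (- 'X - 'X%:P) (br y x).

Record lieConfAlg : Type := LieConfAlg {
  lca_sort :> lmodType {poly K};
  lca_br : lca_sort -> lca_sort -> lampoly lca_sort;
  lca_sesquilinear : sesquilinear lca_br;
  lca_skew : forall x y, skew lca_br x y;
  lca_jacobi : forall x y z, jacobi lca_br lca_br x y z
}.

Record confModule (R : lieConfAlg) : Type := ConfModule {
  cm_sort :> lmodType {poly K};
  cm_act : R -> cm_sort -> lampoly cm_sort;
  cm_sesquilinear : sesquilinear cm_act;
  cm_jacobi : forall x y v, jacobi (@lca_br R) cm_act x y v
}.

Definition free_rank_one (V : lmodType {poly K}) : Prop :=
  exists v : V, forall w, exists! p : {poly K}, w = p *: v.

Definition cm_iso (R : lieConfAlg) (V W : confModule R) : Prop :=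
  exists f : {linear V -> W}, bijective f /\
    forall x v n, lcoef n (cm_act x (f v)) = f (lcoef n (cm_act x v)).

Definition conf_submodule (R : lieConfAlg) (V : confModule R) (N : V -> Prop) :
    Prop :=
  [/\ N 0, forall v w, N v -> N w -> N (v + w),
      forall p v, N v -> N (p *: v)
    & forall x v n, N v -> N (lcoef n (cm_act x v))].

Definition irreducible (R : lieConfAlg) (V : confModule R) : Prop :=
  (exists v : V, v <> 0) /\
  forall N : V -> Prop, conf_submodule N ->
    (forall v, N v -> v = 0) \/ (forall v, N v).

End Conformal.

(** * Reduction of the axioms to generators *)

Section Subst.
Variables (S : comNzRingType) (V : lmodType S) (T : comNzRingType).
Variables (W : lmodType T) (phi : {rmorphism S -> T}) (iota : V -> W).
Hypothesis iotaD : {morph iota : u v / u + v}.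
Hypothesis iotaZ : forall a v, iota (a *: v) = phi a *: iota v.

Let iota0 : iota 0 = 0.
Proof. by rewrite -(scale0r 0) iotaZ rmorph0 scale0r. Qed.

Lemma lsubstE s (f : lampoly V) n : (forall k, (n <= k)%N -> lcoef k f = 0) ->
  lsubst iota s f = \sum_(k < n) s ^+ k *: iota (lcoef k f).
Proof.
move=> fn; rewrite -(big_mkord xpredT (fun k => s ^+ k *: iota (lcoef k f))).
rewrite /index_iota subn0 (bigID [in msupp f]) /= [X in _ + X]big1 ?addr0.
  rewrite -big_filter; apply: perm_big; apply: uniq_perm.
  - exact: fset_uniq.
  - by rewrite filter_uniq // iota_uniq.
  move=> k; rewrite mem_filter mem_iota add0n /=.
  case: (boolP (k \in msupp f)) => //= hk; apply/esym.
  rewrite ltnNge; apply/negP => /fn /eqP; rewrite /lcoef mcoeff_eq0.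
  by rewrite hk.
by move=> k hk; rewrite /lcoef mcoeff_outdom // iota0 scaler0.
Qed.

Lemma lbound (f : lampoly V) :
  exists n, forall m, (n <= m)%N -> forall k, (m <= k)%N -> lcoef k f = 0.
Proof.
exists (\max_(k <- msupp f) k).+1 => m nm k mk.
apply: mcoeff_outdom; apply/negP => hk.
have := leq_trans nm mk; rewrite ltnNge => /negP; apply.
exact: (@leq_bigmax_seq _ _ xpredT id).
Qed.

Lemma lsubstD s : {morph lsubst iota s : f g / f + g}.
Proof.
move=> f g; have [n fn] := lbound f; have [m gm] := lbound g.
have [h1 h2] := (fn (maxn n m) (leq_maxl _ _), gm (maxn n m) (leq_maxr _ _)).
rewrite (lsubstE _ h1) (lsubstE _ h2) (@lsubstE _ _ (maxn n m)); last first.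
  by move=> k hk; rewrite raddfD /= h1 // h2 // addr0.
by rewrite -big_split; apply: eq_bigr => k _; rewrite raddfD iotaD scalerDr.
Qed.

Lemma lsubst0 s : lsubst iota s 0 = 0.
Proof. by apply: (addrI (lsubst iota s 0)); rewrite -lsubstD !addr0. Qed.

Lemma lcoefCZ c (f : lampoly V) n : lcoef n (c%:P *: f) = c *: lcoef n f.
Proof.
rewrite lcoefZ big_ord_recl coefC eqxx subn0 big1 ?addr0 // => i _.
by rewrite coefC scale0r.
Qed.

Lemma lcoefXZ (f : lampoly V) n :
  lcoef n ('X *: f) = if n is m.+1 then lcoef m f else 0.
Proof.
rewrite lcoefZ big_ord_recl coefX scale0r add0r.
case: n => [|n]; first by rewrite big_ord0.
rewrite big_ord_recl coefX scale1r /= subSS subn0 big1 ?addr0 // => i _.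
by rewrite coefX scale0r.
Qed.

Lemma lsubstCZ s c (f : lampoly V) :
  lsubst iota s (c%:P *: f) = phi c *: lsubst iota s f.
Proof.
have [n /(_ n (leqnn _)) fn] := lbound f.
rewrite !(@lsubstE _ _ (n)) //; last by move=> k hk; rewrite lcoefCZ fn ?scaler0.
rewrite scaler_sumr; apply: eq_bigr => k _.
by rewrite lcoefCZ iotaZ !scalerA mulrC.
Qed.

Lemma lsubstXZ s (f : lampoly V) :
  lsubst iota s ('X *: f) = s *: lsubst iota s f.
Proof.
have [n /(_ n (leqnn _)) fn] := lbound f.
rewrite (@lsubstE _ _ (n.+1)); last first.
  by case=> // k hk; rewrite lcoefXZ fn.
rewrite (lsubstE _ fn) big_ord_recl lcoefXZ iota0 scaler0 add0r scaler_sumr.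
by apply: eq_bigr => k _; rewrite lcoefXZ scalerA exprS.
Qed.

Lemma lsubstZ s p (f : lampoly V) :
  lsubst iota s (p *: f) = (map_poly phi p).[s] *: lsubst iota s f.
Proof.
elim/poly_ind: p f => [|p c IHp] f.
  by rewrite scale0r rmorph0 horner0 scale0r lsubst0.
rewrite scalerDl lsubstD lsubstCZ -scalerA IHp lsubstXZ.
rewrite rmorphD rmorphM /= map_polyX map_polyC hornerMXaddC scalerDl scalerA.
by [].
Qed.

Lemma lsubst_const s v : lsubst iota s (lconst v) = iota v.
Proof.
rewrite (@lsubstE _ _ (1)); first by rewrite big_ord1 scale1r /lcoef mcoeffUU.
by case=> // k _; rewrite /lcoef mcoeffU.
Qed.

End Subst.

Lemma lconstZ (S : comNzRingType) (V : lmodType S) c (v : V) :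
  lconst (c *: v) = c%:P *: lconst v.
Proof.
apply: lcoefP => n; rewrite lcoefCZ /lcoef !mcoeffU.
by case: eqP; rewrite ?mulr1n ?mulr0n ?scaler0.
Qed.

Section IotaLinear.
Variables (S : comNzRingType) (V : lmodType S) (T : comNzRingType).
Variables (W : lmodType T) (s : T) (f : lampoly V).

Lemma eq_lsubst (i1 i2 : V -> W) : i1 =1 i2 -> lsubst i1 s f = lsubst i2 s f.
Proof. by move=> e; apply: eq_bigr => k _; rewrite e. Qed.

Lemma lsubst_iotaD (i1 i2 : V -> W) :
  lsubst (fun v => i1 v + i2 v) s f = lsubst i1 s f + lsubst i2 s f.
Proof. by rewrite -big_split; apply: eq_bigr => k _; rewrite scalerDr. Qed.

Lemma lsubst_iotaZ c (i : V -> W) :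
  lsubst (fun v => c *: i v) s f = c *: lsubst i s f.
Proof.
by rewrite scaler_sumr; apply: eq_bigr => k _; rewrite !scalerA mulrC.
Qed.

End IotaLinear.

Lemma subr_addE (W : zmodType) (x y z x' y' z' : W) :
  x - y = z -> x' - y' = z' -> (x + x') - (y + y') = z + z'.
Proof. by move=> <- <-; rewrite opprD addrACA. Qed.

Lemma subr_scaleE (T : comNzRingType) (W : lmodType T) (p q r : T) (x y z : W) :
  p = r -> q = r -> x - y = z -> p *: x - q *: y = r *: z.
Proof. by move=> -> -> <-; rewrite scalerBr. Qed.

Section Generators.
Variable K : fieldType.
Local Notation T1 := {poly {poly K}}.
Local Notation T2 := {poly {poly {poly K}}}.

(* p(d) |-> p(s), for s in K[d][lambda], resp. in K[d][lambda][mu]. *)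
Definition psub1 (s : T1) : {poly K} -> T1 :=
  horner_eval s \o map_poly (polyC \o polyC).
Definition psub2 (s : T2) : {poly K} -> T2 :=
  horner_eval s \o map_poly (polyC \o (polyC \o polyC)).

Definition cc2 : {poly K} -> T2 := polyC \o polyC.

HB.instance Definition _ s := GRing.RMorphism.on (psub1 s).
HB.instance Definition _ s := GRing.RMorphism.on (psub2 s).
HB.instance Definition _ := GRing.RMorphism.on cc2.

Lemma psub1C s c : psub1 s c%:P = c%:P%:P.
Proof. by rewrite /psub1 /= map_polyC /= /horner_eval hornerC. Qed.
Lemma psub1X s : psub1 s 'X = s.
Proof. by rewrite /psub1 /= map_polyX /= /horner_eval hornerX. Qed.
Lemma psub2C s c : psub2 s c%:P = c%:P%:P%:P.
Proof. by rewrite /psub2 /= map_polyC /= /horner_eval hornerC. Qed.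
Lemma psub2X s : psub2 s 'X = s.
Proof. by rewrite /psub2 /= map_polyX /= /horner_eval hornerX. Qed.

(* A d + B lambda + C, and its image after substituting for d and lambda. *)
Definition lin3 (A B C : K) : T1 := A%:P%:P * 'X%:P + B%:P%:P * 'X + C%:P%:P.

Lemma lin3_subst (phi : {rmorphism {poly K} -> T2}) (s : T2) A B C :
  (forall c, phi c%:P = c%:P%:P%:P) ->
  (map_poly phi (lin3 A B C)).[s]
  = A%:P%:P%:P * phi 'X + B%:P%:P%:P * s + C%:P%:P%:P.
Proof.
move=> phiC; rewrite /lin3 !rmorphD !rmorphM /= !map_polyC map_polyX.
by rewrite !hornerD !hornerM !hornerC hornerX /= !phiC.
Qed.

Lemma lin3_psub2 t s A B C : (map_poly (psub2 t) (lin3 A B C)).[s]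
  = A%:P%:P%:P * t + B%:P%:P%:P * s + C%:P%:P%:P.
Proof. by rewrite (lin3_subst _ _ _ _ (psub2C t)) /= psub2X. Qed.

Lemma lin3_cc2 s A B C : (map_poly cc2 (lin3 A B C)).[s]
  = A%:P%:P%:P * 'X%:P%:P + B%:P%:P%:P * s + C%:P%:P%:P.
Proof. by rewrite lin3_subst. Qed.

Lemma rmorph_psub1 (g : {rmorphism T1 -> T1}) t p :
  (forall c, g c%:P%:P = c%:P%:P) -> g (psub1 t p) = psub1 (g t) p.
Proof.
move=> gC; elim/poly_ind: p => [|p c IHp]; first by rewrite !rmorph0.
by rewrite !(rmorphD, rmorphM) /= !psub1X !psub1C gC IHp.
Qed.

Lemma rmorph_psub2 (g : {rmorphism T1 -> T2}) t p :
  (forall c, g c%:P%:P = c%:P%:P%:P) -> g (psub1 t p) = psub2 (g t) p.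
Proof.
move=> gC; elim/poly_ind: p => [|p c IHp]; first by rewrite !rmorph0.
by rewrite !(rmorphD, rmorphM) /= psub1X psub2X psub1C psub2C gC IHp.
Qed.

Lemma hmap_psub2 (phi : {rmorphism {poly K} -> T2}) (s : T2) t p :
  (forall c, phi c%:P = c%:P%:P%:P) ->
  (map_poly phi (psub1 t p)).[s] = psub2 ((map_poly phi t).[s]) p.
Proof.
move=> phiC; apply: (@rmorph_psub2 (horner_eval s \o map_poly phi)) => c.
by rewrite /= map_polyC /= phiC /horner_eval hornerC.
Qed.

Lemma hmap_psub1 (s : T1) t p :
  (map_poly polyC (psub1 t p)).[s] = psub1 ((map_poly polyC t).[s]) p.
Proof.
apply: (@rmorph_psub1 (horner_eval s \o map_poly polyC)) => c.
by rewrite /= map_polyC /= /horner_eval hornerC.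
Qed.

Lemma lsubst_const1Z (R : lmodType {poly K}) s p (f : lampoly R) :
  lsubst (@lconst _ R) s (p *: f) = (map_poly polyC p).[s] *: lsubst (@lconst _ R) s f.
Proof.
apply: lsubstZ => [u v|a v]; first by rewrite raddfD.
by rewrite lconstZ.
Qed.

Section Act.
Variables (R V : lmodType {poly K}) (act : R -> V -> lampoly V).
Hypothesis ses : sesquilinear act.

Lemma sesqZl p x v : act (p *: x) v = psub1 (- 'X) p *: act x v.
Proof.
elim/poly_ind: p x => [|p c IHp] x.
  rewrite rmorph0 !scale0r.
  by rewrite -[X in act X _](scale0r (0 : R)) -polyC0 (sesqCl ses) !polyC0 scale0r.
rewrite scalerDl (sesqDl ses) (sesqCl ses) -scalerA IHp (sesqXl ses).
by rewrite rmorphD rmorphM /= psub1X psub1C scalerDl scalerA.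
Qed.

Lemma sesqZr p x v : act x (p *: v) = psub1 ('X%:P + 'X) p *: act x v.
Proof.
elim/poly_ind: p v => [|p c IHp] v.
  rewrite rmorph0 !scale0r.
  by rewrite -[X in act _ X](scale0r (0 : V)) -polyC0 (sesqCr ses) !polyC0 scale0r.
rewrite scalerDl (sesqDr ses) (sesqCr ses) -scalerA IHp (sesqXr ses).
by rewrite rmorphD rmorphM /= psub1X psub1C scalerA -scalerDl.
Qed.

Lemma act_at_lin s p (f : lampoly V) :
  lsubst (fun w : V => lconst (lconst w)) s (p *: f)
  = (map_poly cc2 p).[s] *: lsubst (fun w : V => lconst (lconst w)) s f.
Proof.
apply: lsubstZ => [u v|a v]; first by rewrite !raddfD.
by rewrite !lconstZ.
Qed.

Lemma act_at_add s :
  {morph lsubst (fun w : V => lconst (lconst w)) s : f g / f + g}.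
Proof.
apply: (@lsubstD _ _ _ _ cc2) => [u v|a v]; first by rewrite !raddfD.
by rewrite !lconstZ.
Qed.

Lemma sesq0l v : act 0 v = 0.
Proof. by rewrite -[X in act X _](scale0r (0 : R)) sesqZl rmorph0 scale0r. Qed.

Lemma sesq0r x : act x 0 = 0.
Proof. by rewrite -[X in act _ X](scale0r (0 : V)) sesqZr rmorph0 scale0r. Qed.

Lemma lsubst_cc0 s : lsubst (fun w : V => lconst (lconst w)) s 0 = 0.
Proof. by rewrite -[X in lsubst _ _ X](scale0r 0) act_at_lin rmorph0 horner0 scale0r. Qed.

Lemma act_at0l s v : act_at act s 0 v = 0.
Proof. by rewrite /act_at sesq0l lsubst_cc0. Qed.

Lemma act_at0r s x : act_at act s x 0 = 0.
Proof. by rewrite /act_at sesq0r lsubst_cc0. Qed.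

Lemma act_atDl s v : {morph (act_at act s)^~ v : x y / x + y}.
Proof. by move=> x y; rewrite /act_at (sesqDl ses) act_at_add. Qed.
Lemma act_atDr s x : {morph act_at act s x : v w / v + w}.
Proof. by move=> v w; rewrite /act_at (sesqDr ses) act_at_add. Qed.

Lemma act_atZl s p x v : act_at act s (p *: x) v = psub2 (- s) p *: act_at act s x v.
Proof.
rewrite /act_at sesqZl act_at_lin hmap_psub2 //.
by rewrite rmorphN /= map_polyX hornerN hornerX.
Qed.

Lemma act_atZr s p x v :
  act_at act s x (p *: v) = psub2 (del2 K + s) p *: act_at act s x v.
Proof.
rewrite /act_at sesqZr act_at_lin hmap_psub2 //.
by rewrite rmorphD /= map_polyX map_polyC hornerD hornerX hornerC.
Qed.

Lemma lsubst_actr s t x (f : lampoly V) p :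
  lsubst (act_at act s x) t (p *: f)
  = (map_poly (psub2 (del2 K + s)) p).[t] *: lsubst (act_at act s x) t f.
Proof. by apply: lsubstZ => [u v|a v]; rewrite (act_atDr, act_atZr). Qed.

Lemma lsubst_actl s t v (f : lampoly R) p :
  lsubst ((act_at act s)^~ v) t (p *: f)
  = (map_poly (psub2 (- s)) p).[t] *: lsubst ((act_at act s)^~ v) t f.
Proof. by apply: lsubstZ => [u w|a w]; rewrite (act_atDl, act_atZl). Qed.

Lemma lsubst_actr0 s t x : lsubst (act_at act s x) t 0 = 0.
Proof. by rewrite -[X in lsubst _ _ X](scale0r 0) lsubst_actr rmorph0 horner0 scale0r. Qed.

Lemma lsubst_actl0 s t v : lsubst ((act_at act s)^~ v) t 0 = 0.
Proof. by rewrite -[X in lsubst _ _ X](scale0r 0) lsubst_actl rmorph0 horner0 scale0r. Qed.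

Lemma lsubst_act0l s t f : lsubst (act_at act s 0) t f = 0.
Proof. by apply: big1 => k _; rewrite act_at0l scaler0. Qed.

Lemma lsubst_act0r s t f : lsubst ((act_at act s)^~ 0) t f = 0.
Proof. by apply: big1 => k _; rewrite act_at0r scaler0. Qed.

Lemma lsubst_actrE s t p x w : lsubst (act_at act s x) t (p *: lconst w) =
  (map_poly (psub2 (del2 K + s)) p).[t] *: act_at act s x w.
Proof.
rewrite lsubst_actr; congr (_ *: _).
apply: (@lsubst_const _ _ _ _ (psub2 (del2 K + s))) => q u; exact: act_atZr.
Qed.

Lemma lsubst_actlE s t p v w : lsubst ((act_at act s)^~ v) t (p *: lconst w) =
  (map_poly (psub2 (- s)) p).[t] *: act_at act s w v.
Proof.
rewrite lsubst_actl; congr (_ *: _).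
exact: (@lsubst_const _ _ _ _ (psub2 (- s)) _ (fun q u => act_atZl s q u v)).
Qed.

Lemma lsubst_ccE s p w :
  lsubst (fun w : V => lconst (lconst w)) s (p *: lconst w)
  = (map_poly cc2 p).[s] *: lconst (lconst w).
Proof.
rewrite act_at_lin; congr (_ *: _).
by apply: (@lsubst_const _ _ _ _ cc2) => q u; rewrite !lconstZ.
Qed.

Lemma lsubst_actrD s t x :
  {morph lsubst (act_at act s x) t : f g / f + g}.
Proof.
by apply: (@lsubstD _ _ _ _ (psub2 (del2 K + s))) => [u v|a v];
  rewrite (act_atDr, act_atZr).
Qed.

Lemma lsubst_actlD s t v :
  {morph lsubst ((act_at act s)^~ v) t : f g / f + g}.
Proof.
by apply: (@lsubstD _ _ _ _ (psub2 (- s))) => [u w|a w];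
  rewrite (act_atDl, act_atZl).
Qed.

Lemma lsubst_actD2r s t x y (f : lampoly R) :
  lsubst (fun z => act_at act s z (x + y)) t f =
  lsubst (fun z => act_at act s z x) t f + lsubst (fun z => act_at act s z y) t f.
Proof. by rewrite -lsubst_iotaD; apply: eq_lsubst => z; exact: act_atDr. Qed.

Lemma lsubst_actD2l s t x y (f : lampoly V) :
  lsubst (act_at act s (x + y)) t f =
  lsubst (act_at act s x) t f + lsubst (act_at act s y) t f.
Proof. by rewrite -lsubst_iotaD; apply: eq_lsubst => z; exact: act_atDl. Qed.

Lemma lsubst_actZ2r s t p x (f : lampoly R) :
  lsubst (fun z => act_at act s z (p *: x)) t f =
  psub2 (del2 K + s) p *: lsubst (fun z => act_at act s z x) t f.
Proof. by rewrite -lsubst_iotaZ; apply: eq_lsubst => z; exact: act_atZr. Qed.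

Lemma lsubst_actZ2l s t p x (f : lampoly V) :
  lsubst (act_at act s (p *: x)) t f =
  psub2 (- s) p *: lsubst (act_at act s x) t f.
Proof. by rewrite -lsubst_iotaZ; apply: eq_lsubst => z; exact: act_atZl. Qed.

End Act.

Section Jacobi.
Variables (R V : lmodType {poly K}) (act : R -> V -> lampoly V).
Hypothesis ses : sesquilinear act.
Variable br : R -> R -> lampoly R.
Hypothesis sesb : sesquilinear br.
Local Notation lam2 := (lam2 K).
Local Notation mu2 := (mu2 K).
Local Notation del2 := (del2 K).
Local Notation J := (jacobi br act).

Lemma jacobiDr x y v w : J x y v -> J x y w -> J x y (v + w).
Proof.
rewrite /jacobi => h1 h2; rewrite (lsubst_actD2r ses).
rewrite (sesqDr ses y) (sesqDr ses x) !(lsubst_actrD ses).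
exact: subr_addE h1 h2.
Qed.

Lemma jacobiDm x y z v : J x y v -> J x z v -> J x (y + z) v.
Proof.
rewrite /jacobi => h1 h2; rewrite (lsubst_actD2l ses).
rewrite (sesqDl ses y) (sesqDr sesb x) (lsubst_actrD ses) (lsubst_actlD ses).
exact: subr_addE h1 h2.
Qed.

Lemma jacobiDl x y z v : J x y v -> J z y v -> J (x + z) y v.
Proof.
rewrite /jacobi => h1 h2; rewrite (lsubst_actD2l ses).
rewrite (sesqDl ses x) (sesqDl sesb x) (lsubst_actrD ses) (lsubst_actlD ses).
exact: subr_addE h1 h2.
Qed.

Lemma jacobiZr p x y v : J x y v -> J x y (p *: v).
Proof.
rewrite /jacobi => h; rewrite (lsubst_actZ2r ses) !(sesqZr ses).
rewrite !(lsubst_actr ses) !hmap_psub2; try exact: psub2C.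
apply: subr_scaleE h; congr psub2.
  by rewrite rmorphD /= map_polyX map_polyC hornerD hornerX hornerC /= psub2X addrA.
rewrite rmorphD /= map_polyX map_polyC hornerD hornerX hornerC /= psub2X.
by rewrite -addrA [mu2 + _]addrC.
Qed.

Lemma jacobiZm p x y v : J x y v -> J x (p *: y) v.
Proof.
rewrite /jacobi => h; rewrite (lsubst_actZ2l ses) (sesqZl ses) (sesqZr sesb).
rewrite (lsubst_actr ses) (lsubst_actl ses) !hmap_psub2; try exact: psub2C.
apply: subr_scaleE h; congr psub2.
  rewrite rmorphN /= map_polyX hornerN hornerX rmorphD /= map_polyX map_polyC.
  by rewrite hornerD hornerX hornerC /= psub2X opprD addrAC addNr add0r.
rewrite rmorphD /= map_polyX map_polyC.
by rewrite hornerD hornerX hornerC /= psub2X opprD addrAC addNr add0r.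
Qed.

Lemma jacobiZl p x y v : J x y v -> J (p *: x) y v.
Proof.
rewrite /jacobi => h; rewrite (lsubst_actZ2l ses) (sesqZl ses) (sesqZl sesb).
rewrite (lsubst_actr ses) (lsubst_actl ses) !hmap_psub2; try exact: psub2C.
by apply: subr_scaleE h; congr psub2;
  rewrite !rmorphN /= !map_polyX !hornerN !hornerX.
Qed.

Lemma jacobi_gen x y z (u v w t : V) p q r p' q' r' :
  br x y = p *: lconst z ->
  act y v = q *: lconst u -> act x v = r *: lconst w ->
  act x u = q' *: lconst t -> act y w = r' *: lconst t ->
  act z v = p' *: lconst t ->
  (map_poly (psub2 (del2 + lam2)) q).[mu2] * (map_poly cc2 q').[lam2]
    - (map_poly (psub2 (del2 + mu2)) r).[lam2] * (map_poly cc2 r').[mu2]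
  = (map_poly (psub2 (- (lam2 + mu2))) p).[lam2] * (map_poly cc2 p').[lam2 + mu2] ->
  J x y v.
Proof.
move=> e1 e2 e3 e4 e5 e6 h; rewrite /jacobi e1 e2 e3.
have at1 : act_at act lam2 x u = (map_poly cc2 q').[lam2] *: lconst (lconst t).
  by rewrite /act_at e4; exact: lsubst_ccE.
have at2 : act_at act mu2 y w = (map_poly cc2 r').[mu2] *: lconst (lconst t).
  by rewrite /act_at e5; exact: lsubst_ccE.
have at3 : act_at act (lam2 + mu2) z v =
    (map_poly cc2 p').[lam2 + mu2] *: lconst (lconst t).
  by rewrite /act_at e6; exact: lsubst_ccE.
have s1 := lsubst_actrE ses lam2 mu2 q x u.
have s2 := lsubst_actrE ses mu2 lam2 r y w.
have s3 := lsubst_actlE ses (lam2 + mu2) lam2 p v z.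
rewrite at1 scalerA in s1; rewrite at2 scalerA in s2; rewrite at3 scalerA in s3.
apply: etrans (esym s3); rewrite -h scalerBl.
exact: (congr2 (fun s t => s - t) s1 s2).
Qed.

(* The Jacobi identity for x, y, v whose products are all of the shape
   (A d + B lambda + C) * (element) is an identity between the coefficients,
   which can be checked in any commutative K-algebra. *)
Lemma jacobi_lin3 x y z (u v w t : V) A1 B1 C1 A2 B2 C2 A3 B3 C3
    A4 B4 C4 A5 B5 C5 A6 B6 C6 :
  br x y = lin3 A1 B1 C1 *: lconst z ->
  act y v = lin3 A2 B2 C2 *: lconst u -> act x v = lin3 A3 B3 C3 *: lconst w ->
  act x u = lin3 A4 B4 C4 *: lconst t -> act y w = lin3 A5 B5 C5 *: lconst t ->
  act z v = lin3 A6 B6 C6 *: lconst t ->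
  (forall (T : comNzRingType) (f : {rmorphism K -> T}) (d l m : T),
    (f A2 * (d + l) + f B2 * m + f C2) * (f A4 * d + f B4 * l + f C4)
    - (f A3 * (d + m) + f B3 * l + f C3) * (f A5 * d + f B5 * m + f C5)
    = (f A1 * - (l + m) + f B1 * l + f C1)
      * (f A6 * d + f B6 * (l + m) + f C6)) ->
  J x y v.
Proof.
move=> e1 e2 e3 e4 e5 e6 h.
apply: (jacobi_gen e1 e2 e3 e4 e5 e6); rewrite !lin3_psub2 !lin3_cc2.
exact: (h T2 (polyC \o (polyC \o polyC)) del2 lam2 mu2).
Qed.

Local Notation Sk := (skew br).

Lemma lsubst_const1D s :
  {morph lsubst (@lconst _ R) s : f g / f + g}.
Proof.
apply: (@lsubstD _ _ _ _ polyC) => [u v|a v]; first by rewrite raddfD.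
by rewrite lconstZ.
Qed.

Lemma lsubst_const10 s : lsubst (@lconst _ R) s 0 = 0.
Proof. by rewrite -[X in lsubst _ _ X](scale0r 0) lsubst_const1Z rmorph0 horner0 scale0r. Qed.

Lemma lsubst_const1E s p w :
  lsubst (@lconst _ R) s (p *: lconst w) = (map_poly polyC p).[s] *: lconst w.
Proof.
rewrite lsubst_const1Z; congr (_ *: _).
by apply: (@lsubst_const _ _ _ _ polyC) => q u; rewrite lconstZ.
Qed.

Lemma jacobi0l y v : J 0 y v.
Proof.
by rewrite /jacobi !sesq0l // lsubst_actr0 // lsubst_actl0 // lsubst_act0l // subrr.
Qed.

Lemma jacobi0m x v : J x 0 v.
Proof.
rewrite /jacobi (sesq0l ses) (sesq0r sesb) lsubst_actr0 // lsubst_actl0 //.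
by rewrite lsubst_act0l // subrr.
Qed.

Lemma jacobi0r x y : J x y 0.
Proof.
by rewrite /jacobi !(sesq0r ses) !lsubst_actr0 // lsubst_act0r // subrr.
Qed.

Lemma skew0l y : Sk 0 y.
Proof. by rewrite /skew sesq0l // sesq0r // lsubst_const10 oppr0. Qed.

Lemma skew0r y : Sk y 0.
Proof. by rewrite /skew sesq0l // sesq0r // lsubst_const10 oppr0. Qed.

Lemma skewDl x y z : Sk x y -> Sk z y -> Sk (x + z) y.
Proof.
rewrite /skew => h1 h2.
by rewrite (sesqDl sesb) (sesqDr sesb) lsubst_const1D h1 h2 opprD.
Qed.

Lemma skewDr x y z : Sk x y -> Sk x z -> Sk x (y + z).
Proof.
rewrite /skew => h1 h2.
by rewrite (sesqDl sesb) (sesqDr sesb) lsubst_const1D h1 h2 opprD.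
Qed.

Lemma skewZl p x y : Sk x y -> Sk (p *: x) y.
Proof.
rewrite /skew => h; rewrite (sesqZl sesb) (sesqZr sesb) lsubst_const1Z hmap_psub1 h.
rewrite scalerN; congr (- (_ *: _)); congr psub1.
by rewrite rmorphD /= map_polyX map_polyC hornerD hornerX hornerC /= addrC subrK.
Qed.

Lemma skewZr p x y : Sk x y -> Sk x (p *: y).
Proof.
rewrite /skew => h; rewrite (sesqZl sesb) (sesqZr sesb) lsubst_const1Z hmap_psub1 h.
rewrite scalerN; congr (- (_ *: _)); congr psub1.
by rewrite rmorphN /= map_polyX hornerN hornerX opprD !opprK addrC.
Qed.

End Jacobi.

(* Induction on the free module on [I]. *)
Lemma malg_span (S : comNzRingType) (I : choiceType) (P : {malg S[I]} -> Prop) :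
  P 0 -> (forall u v, P u -> P v -> P (u + v)) ->
  (forall (p : S) u, P u -> P (p *: u)) -> (forall i, P (mkmalgU i 1)) ->
  forall u, P u.
Proof.
move=> P0 PD PZ Pi u; rewrite (monalgE u); elim: (enum_fset _) => [|k s IHs].
  by rewrite big_nil.
rewrite big_cons; apply: PD => //.
rewrite (_ : mkmalgU k u@_k = u@_k *: mkmalgU k 1); first exact: PZ.
by apply/malgP => j; rewrite mcoeffZ !mcoeffU; case: eqP; rewrite ?mulr1 ?mulr0.
Qed.

End Generators.

(** * The Lie conformal algebra CHV(a,b) *)

Section MExt.
Variables (S : comNzRingType) (I : choiceType) (W : zmodType).

Definition mext (F : I -> S -> W) (x : {malg S[I]}) : W :=
  \sum_(k <- msupp x) F k x@_k.

Variable F : I -> S -> W.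
Hypothesis FD : forall k, {morph F k : p q / p + q}.

Let F0 k : F k 0 = 0.
Proof. by apply: (addrI (F k 0)); rewrite -FD !addr0. Qed.

Lemma mextw (d : {fset I}) x : (msupp x `<=` d)%fset ->
  mext F x = \sum_(k <- d) F k x@_k.
Proof.
move=> le; apply: big_fset_incl => // k _ hk.
by rewrite mcoeff_outdom.
Qed.

Lemma mextD : {morph mext F : x y / x + y}.
Proof.
move=> x y; rewrite (mextw (msuppD_le x y)).
rewrite (mextw (fsubsetUl (msupp x) (msupp y))).
rewrite (mextw (fsubsetUr (msupp x) (msupp y))) -big_split /=.
by apply: eq_bigr => k _; rewrite mcoeffD FD.
Qed.

Lemma mext0 : mext F 0 = 0.
Proof. by apply: (addrI (mext F 0)); rewrite -mextD !addr0. Qed.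

Lemma mextU k p : mext F (mkmalgU k p) = F k p.
Proof.
by rewrite (mextw (msuppU_le (k := k) (x := p))) big_seq_fset1 mcoeffUU.
Qed.

End MExt.

Lemma mextZ (S : comNzRingType) (I : choiceType) (T : comNzRingType)
    (W : lmodType T) (F : I -> S -> W) (q : S) (t : T) x :
  (forall k, {morph F k : p q / p + q}) ->
  (forall k p, F k (q * p) = t *: F k p) -> mext F (q *: x) = t *: mext F x.
Proof.
move=> FD FZ; rewrite (@mextw _ _ _ _ FD (msupp x)) ?msuppZ_le // scaler_sumr.
by apply: eq_bigr => k _; rewrite mcoeffZ FZ.
Qed.

(* [inl i] is the index of L_i and [inr i] that of M_i. *)
Notation chv_idx := (int + int)%type.

Section CHV.
Variables (K : fieldType) (a b : K).

Definition chv_sort : Type := {malg {poly K}[chv_idx]}.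
HB.instance Definition _ := GRing.Lmodule.on chv_sort.

Definition chvL (i : int) : chv_sort := mkmalgU (inl i) 1.
Definition chvM (i : int) : chv_sort := mkmalgU (inr i) 1.

(* [x_lambda y] for x and y in the basis; [M_i _lambda L_j] is
   - [L_j _{- lambda - d} M_i]. *)
Definition chv_br_basis (k l : chv_idx) : lampoly chv_sort :=
  match k, l with
  | inl i, inl j => ('X%:P + 'X *+ 2) *: lconst (chvL (i + j))
  | inl i, inr j => ('X%:P + a%:P%:P * 'X + b%:P%:P) *: lconst (chvM (i + j))
  | inr i, inl j =>
      (- ('X%:P + a%:P%:P * (- 'X - 'X%:P) + b%:P%:P)) *: lconst (chvM (i + j))
  | inr _, inr _ => 0
  end.

(* The coefficients (A, B, C) of the same brackets in the uniform shape
   (A d + B lambda + C) * (basis element). *)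
Definition chv_coef (k l : chv_idx) : K * K * K :=
  match k, l with
  | inl _, inl _ => (1, 2%:R, 0)
  | inl _, inr _ => (1, a, b)
  | inr _, inl _ => (a - 1, a, - b)
  | inr _, inr _ => (0, 0, 0)
  end.

Definition chv_add (k l : chv_idx) : chv_idx :=
  match k, l with
  | inl i, inl j => inl (i + j)
  | inl i, inr j | inr i, inl j | inr i, inr j => inr (i + j)
  end.

Lemma chv_br_basisE k l : chv_br_basis k l =
  lin3 (chv_coef k l).1.1 (chv_coef k l).1.2 (chv_coef k l).2
    *: lconst (mkmalgU (chv_add k l) 1 : chv_sort).
Proof.
case: k l => [i|i] [j|j] /=.
- by congr (_ *: _); rewrite /lin3; ring.
- by congr (_ *: _); rewrite /lin3; ring.
- by congr (_ *: _); rewrite /lin3; ring.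
- by rewrite /lin3 !polyC0 !mul0r !addr0 scale0r.
Qed.

Lemma chv_addC k l : chv_add k l = chv_add l k.
Proof. by case: k l => [i|i] [j|j] /=; rewrite addrC. Qed.

Lemma chv_addA k l m : chv_add k (chv_add l m) = chv_add (chv_add k l) m.
Proof. by case: k l m => [i|i] [j|j] [m|m] /=; rewrite addrA. Qed.

(* [p(d) x_lambda q(d) y] = p(- lambda) q(d + lambda) [x_lambda y]. *)
Definition chv_br (x y : chv_sort) : lampoly chv_sort :=
  mext (fun k p => mext (fun l q =>
    (psub1 (- 'X) p * psub1 ('X%:P + 'X) q) *: chv_br_basis k l) y) x.

Lemma chv_br_FDr k p l : {morph (fun q => (psub1 (- 'X) p * psub1 ('X%:P + 'X) q)
  *: chv_br_basis k l) : u v / u + v}.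
Proof. by move=> u v /=; rewrite rmorphD mulrDr scalerDl. Qed.

Lemma chv_br_FDl y k : {morph (fun p => mext (fun l q =>
    (psub1 (- 'X) p * psub1 ('X%:P + 'X) q) *: chv_br_basis k l) y) : u v / u + v}.
Proof.
move=> u v; rewrite /mext -big_split; apply: eq_bigr => l _.
by rewrite rmorphD mulrDl scalerDl.
Qed.

Lemma chv_brDl x y z : chv_br (x + y) z = chv_br x z + chv_br y z.
Proof. exact/mextD/chv_br_FDl. Qed.

Lemma chv_brDr x y z : chv_br x (y + z) = chv_br x y + chv_br x z.
Proof.
rewrite /chv_br /mext -big_split; apply: eq_bigr => k _.
exact: (mextD (chv_br_FDr k x@_k) y z).
Qed.

Lemma chv_brZl p x y : chv_br (p *: x) y = psub1 (- 'X) p *: chv_br x y.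
Proof.
apply: mextZ => [k|k q]; first exact: chv_br_FDl.
rewrite /mext scaler_sumr; apply: eq_bigr => l _.
by rewrite rmorphM scalerA mulrA.
Qed.

Lemma chv_brZr p x y : chv_br x (p *: y) = psub1 ('X%:P + 'X) p *: chv_br x y.
Proof.
rewrite /chv_br [RHS]scaler_sumr; apply: eq_bigr => k _.
apply: mextZ => [l|l q]; first exact: chv_br_FDr.
by rewrite rmorphM scalerA mulrCA.
Qed.

Lemma chv_sesquilinear : sesquilinear chv_br.
Proof.
split=> *; first [exact: chv_brDl | exact: chv_brDr | idtac].
- by rewrite chv_brZl psub1C.
- by rewrite chv_brZr psub1C.
- by rewrite chv_brZl psub1X.
- by rewrite chv_brZr psub1X.
Qed.

Lemma chv_brE k l : chv_br (mkmalgU k 1) (mkmalgU l 1) = chv_br_basis k l.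
Proof.
rewrite /chv_br mextU; last exact: chv_br_FDl.
by rewrite mextU; [rewrite !rmorph1 mulr1 scale1r | exact: chv_br_FDr].
Qed.

Lemma chv_skew x y : skew chv_br x y.
Proof.
have sb := chv_sesquilinear.
elim/malg_span: x => [|u v|p u|k]; [exact: skew0l|exact: skewDl|exact: skewZl|].
elim/malg_span: y => [|u v|p u|l]; [exact: skew0r|exact: skewDr|exact: skewZr|].
rewrite /skew !chv_brE.
case: k l => [i|i] [j|j] /=; rewrite ?lsubst_const1E ?lsubst_const10 ?oppr0 //;
  rewrite -scaleNr [j + i]addrC; congr (_ *: _);
  rewrite !(rmorphD, rmorphM, rmorphN, rmorphMn) /= ?map_polyX ?map_polyC;
  rewrite !(hornerD, hornerN, hornerMn, hornerM, hornerC, hornerX) /=; ring.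
Qed.

Lemma chv_jacobi x y z : jacobi chv_br chv_br x y z.
Proof.
have sb := chv_sesquilinear.
elim/malg_span: x => [|u v|p u|k];
  [exact: jacobi0l|exact: jacobiDl|exact: jacobiZl|].
elim/malg_span: y => [|u v|p u|l];
  [exact: jacobi0m|exact: jacobiDm|exact: jacobiZm|].
elim/malg_span: z => [|u v|p u|m];
  [exact: jacobi0r|exact: jacobiDr|exact: jacobiZr|].
have E := chv_br_basisE; have bE i j := etrans (chv_brE i j) (E i j).
have eqkl : chv_add l (chv_add k m) = chv_add k (chv_add l m).
  by rewrite !chv_addA [chv_add l k]chv_addC.
have bkm := bE l (chv_add k m); rewrite eqkl in bkm.
have bklm := bE (chv_add k l) m; rewrite -chv_addA in bklm.
apply: (jacobi_lin3 sb (bE k l) (bE l m) (bE k m) (bE k _) bkm bklm) => T f d u v.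
by clear bE eqkl bkm bklm; case: k l m => [i|i] [j|j] [k|k] /=; ring.
Qed.

Definition CHV : lieConfAlg K := LieConfAlg chv_sesquilinear chv_skew chv_jacobi.

End CHV.

(** * The modules M'(alpha,beta,c) and M'(alpha,beta,c,d) *)

Section Modules.
Variable K : fieldType.

(* c^i for i in Z, with the convention 0^i = 0 for every i, including i = 0. *)
Definition cpow (c : K) (i : int) : K := if c == 0 then 0 else c ^ i.

Lemma cpowD c i j : cpow c (i + j) = cpow c i * cpow c j.
Proof.
by rewrite /cpow; case: eqVneq => [_|c0]; rewrite ?mulr0 // expfzDr.
Qed.

(* K[d] v is [{poly K}^o], with generator v = 1. *)
Definition rk1_gen : {poly K}^o := 1.

(* The action on K[d] v such that x_lambda v = am k * v, if x is the basis
   element of index k. *)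
Definition rk1_act (am : chv_idx -> {poly {poly K}})
    (x : chv_sort K) (f : {poly K}^o) : lampoly {poly K}^o :=
  mext (fun k p => (psub1 (- 'X) p * psub1 ('X%:P + 'X) f)
                     *: (am k *: lconst rk1_gen)) x.

Definition am3 (alpha beta c : K) (k : chv_idx) : {poly {poly K}} :=
  match k with
  | inl i => (cpow c i)%:P%:P * ('X%:P + alpha%:P%:P * 'X + beta%:P%:P)
  | inr _ => 0
  end.

Definition am4 (alpha beta c d : K) (k : chv_idx) : {poly {poly K}} :=
  match k with
  | inl i => (cpow c i)%:P%:P * ('X%:P + alpha%:P%:P * 'X + beta%:P%:P)
  | inr i => (d * cpow c i)%:P%:P
  end.

Definition am_coef (alpha beta c d : K) (k : chv_idx) : K * K * K :=
  match k with
  | inl i => (cpow c i, cpow c i * alpha, cpow c i * beta)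
  | inr i => (0, 0, d * cpow c i)
  end.

Lemma am4E alpha beta c d k : am4 alpha beta c d k =
  lin3 (am_coef alpha beta c d k).1.1 (am_coef alpha beta c d k).1.2
       (am_coef alpha beta c d k).2.
Proof. by case: k => i; rewrite /lin3 /=; ring. Qed.

Lemma am3E alpha beta c k : am3 alpha beta c k =
  lin3 (am_coef alpha beta c 0 k).1.1 (am_coef alpha beta c 0 k).1.2
       (am_coef alpha beta c 0 k).2.
Proof. by case: k => i; rewrite /lin3 /=; ring. Qed.

Section Act.
Variable am : chv_idx -> {poly {poly K}}.
Local Notation act := (rk1_act am).

Lemma rk1_act_FD f k : {morph (fun p => (psub1 (- 'X) p * psub1 ('X%:P + 'X) f)
    *: (am k *: lconst rk1_gen)) : u v / u + v}.
Proof. by move=> u v; rewrite rmorphD mulrDl scalerDl. Qed.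

Lemma rk1_actZl p x f : act (p *: x) f = psub1 (- 'X) p *: act x f.
Proof.
apply: mextZ => [k|k q]; first exact: rk1_act_FD.
by rewrite rmorphM [RHS]scalerA mulrA.
Qed.

Lemma rk1_actZr p x f : act x (p *: f) = psub1 ('X%:P + 'X) p *: act x f.
Proof.
rewrite /rk1_act [RHS]scaler_sumr; apply: eq_bigr => k _.
by rewrite rmorphM [RHS]scalerA mulrCA.
Qed.

Lemma rk1_sesquilinear : sesquilinear act.
Proof.
split=> [x y f|x f g|c x f|c x f|x f|x f].
- exact/mextD/rk1_act_FD.
- rewrite /rk1_act /mext -big_split; apply: eq_bigr => k _.
  by rewrite rmorphD mulrDr scalerDl.
- by rewrite rk1_actZl psub1C.
- by rewrite rk1_actZr psub1C.
- by rewrite rk1_actZl psub1X.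
- by rewrite rk1_actZr psub1X.
Qed.

Lemma rk1_actE k : act (mkmalgU k 1) rk1_gen = am k *: lconst rk1_gen.
Proof.
rewrite /rk1_act mextU; last exact: rk1_act_FD.
by rewrite !rmorph1 mulr1 scale1r.
Qed.

Lemma rk1_jacobi (a b : K) :
  (forall k l, jacobi (chv_br a b) act (mkmalgU k 1) (mkmalgU l 1) rk1_gen) ->
  forall x y v, jacobi (chv_br a b) act x y v.
Proof.
move=> hgen x y v; have sa := rk1_sesquilinear; have sb := chv_sesquilinear a b.
elim/malg_span: x => [|u w|p u|k];
  [exact: jacobi0l|exact: jacobiDl|exact: jacobiZl|].
elim/malg_span: y => [|u w|p u|l];
  [exact: jacobi0m|exact: jacobiDm|exact: jacobiZm|].
rewrite (_ : v = (v : {poly K}) *: rk1_gen); last by rewrite [RHS]mulr1.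
exact/jacobiZr.
Qed.

Lemma rk1_act_atE s k : act_at act s (mkmalgU k 1) rk1_gen =
  (map_poly (@cc2 K) (am k)).[s] *: lconst (lconst rk1_gen).
Proof. by rewrite /act_at rk1_actE lsubst_ccE. Qed.

End Act.

Lemma am3_jacobi a b alpha beta c x y v :
  jacobi (chv_br a b) (rk1_act (am3 alpha beta c)) x y v.
Proof.
apply: rk1_jacobi => k l.
have mE i : rk1_act (am3 alpha beta c) (mkmalgU i 1) rk1_gen = _ :=
  etrans (rk1_actE _ i) (congr1 (fun p => p *: _) (am3E alpha beta c i)).
apply: (jacobi_lin3 (rk1_sesquilinear _)
  (etrans (chv_brE _ _ k l) (chv_br_basisE _ _ k l))
  (mE l) (mE k) (mE k) (mE l) (mE (chv_add k l))) => T f d' u v'.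
by clear mE; case: k l => [i|i] [j|j] /=; rewrite ?cpowD; ring.
Qed.

Lemma am4_jacobi alpha beta c d x y v :
  jacobi (chv_br 1 0) (rk1_act (am4 alpha beta c d)) x y v.
Proof.
apply: rk1_jacobi => k l.
have mE i : rk1_act (am4 alpha beta c d) (mkmalgU i 1) rk1_gen = _ :=
  etrans (rk1_actE _ i) (congr1 (fun p => p *: _) (am4E alpha beta c d i)).
apply: (jacobi_lin3 (rk1_sesquilinear _)
  (etrans (chv_brE _ _ k l) (chv_br_basisE _ _ k l))
  (mE l) (mE k) (mE k) (mE l) (mE (chv_add k l))) => T f d' u v'.
by clear mE; case: k l => [i|i] [j|j] /=; rewrite ?cpowD; ring.
Qed.

(* M'(alpha,beta,c), over CHV(a,b) for arbitrary a and b. *)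
Definition Mabc (a b alpha beta c : K) : confModule (CHV a b) :=
  @ConfModule K (CHV a b) {poly K}^o (rk1_act (am3 alpha beta c))
    (rk1_sesquilinear (am3 alpha beta c)) (am3_jacobi a b alpha beta c).

(* M'(alpha,beta,c,d), over CHV(1,0). *)
Definition Mabcd (alpha beta c d : K) : confModule (CHV 1 0) :=
  @ConfModule K (CHV 1 0) {poly K}^o (rk1_act (am4 alpha beta c d))
    (rk1_sesquilinear (am4 alpha beta c d)) (am4_jacobi alpha beta c d).

End Modules.

(* Main.v *)
From HB Require Import structures.
Require Import Defs.
From mathcomp Require Import all_boot all_order all_algebra.
From mathcomp Require Import monalg ring.
From mathcomp Require Import boolp reals complex.

(** Let [v] generate the module freely, so that [L_i] and [M_i] act on [v] by
    polynomials [L_i(d, l)] and [M_i(d, l)] in the derivation and the spectral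
    parameter.  The Jacobi identity on [v] says that, for all scalars,
    - [L_j(d+l, m) L_i(d, l) - L_i(d+m, l) L_j(d, m) = (l-m) L_{i+j}(d, l+m)],
    - [M_j(d+l, m) L_i(d, l) - L_i(d+m, l) M_j(d, m)
       = ((a-1)l - m + b) M_{i+j}(d, l+m)],
    - [M_j(d+l, m) M_i(d, l) = M_i(d+m, l) M_j(d, m)]
    ([rank_one_action]).  The ground field has characteristic zero, so these
    equations between values lose nothing, and specialising [l] and [m] cleverly
    solves them.

    The degree in [d] is controlled by [m = -l]: with
    [U(d) = f(d, l) f(d+l, -l)], the left-hand side of the first equation for
    [i = j] becomes the difference [U(d) - U(d-l)].  For [f = M_i] this
    difference vanishes, so [U] is periodic, hence constant, and [M_i] does not
    involve [d] ([commuting_action_const]).  For [f = L_0] it is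
    [2l f(d, 0) = 2l(d + beta)], so [U] is quadratic in [d]; hence [L_0] has
    degree one in [d], and [L_0 = d + alpha l + beta] unless [L_0 = 0]
    ([virasoro_rank_one]).

    Taking [l = m] in the equation for the pair [(0, j)] shows that
    [L_j(d, m) / (d + alpha m + beta)] is invariant under [d -> d + m], so [L_j]
    is a scalar multiple of [L_0] ([virasoro_intertwiner]); the scalars are
    multiplicative in [j], whence [c^j].  With [M_i] independent of [d], the
    second equation at [m = 0] kills [M_i] unless [a = 1] and [b = 0], and then
    at [m = 1] it makes [M_i] proportional to [c^i] ([loop_M_eq0], [loop_M]).

    For irreducibility, a submodule contains, with [p(d) v], every coefficient
    in [lambda] of [p(d + lambda) F(d, lambda) v], where [F] is the action of a
    basis element on [v].  If the leading coefficient of some [F] in [lambda] is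
    a nonzero scalar, the top coefficient recovers [v]
    ([irreducible_of_lead_coef]); if all the [F] share a nonconstant factor
    [q(d)], the multiples of [q(d) v] form a proper submodule
    ([reducible_of_common_factor]).  The first happens for [L_0] when [alpha]
    and [c] are nonzero and for [M_0] when [c] and [d] are, the second with
    [q = d + beta] or, for the zero action, [q = d]. *)

Set Implicit Arguments.
Unset Strict Implicit.
Unset Printing Implicit Defensive.

Import GRing.Theory.
Local Open Scope ring_scope.

(** * Polynomials as functions in characteristic zero *)

Section PolynomialFunctions.
Variable K : fieldType.
Hypothesis K0 : [pchar K] =i pred0.

Lemma natf_eq0 n : (n%:R == 0 :> K) = (n == 0%N).
Proof. by move/pcharf0P: K0; apply. Qed.

Lemma natSf_neq0 n : n.+1%:R != 0 :> K.
Proof. by rewrite natf_eq0. Qed.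

Lemma poly_progression_eq0 (p : {poly K}) x0 h :
  h != 0 -> (forall n, p.[x0 + n%:R * h] = 0) -> p = 0.
Proof.
move=> h0 hp; apply: (@roots_geq_poly_eq0 _ p
  [seq x0 + n%:R * h | n <- iota 0 (size p)]).
- by apply/allP => x /mapP[n _ ->]; rewrite /root hp.
- rewrite map_inj_in_uniq ?iota_uniq // => m n _ _ /addrI /(mulIf h0) /eqP e.
  apply/eqP; wlog lemn : m n e / (m <= n)%N => [hw|].
    by case/orP: (leq_total m n) => h1; [|rewrite eq_sym]; apply: hw; rewrite // eq_sym.
  rewrite eqn_leq lemn -subn_eq0 -natf_eq0 natrB // subr_eq0 eq_sym //.
- by rewrite size_map size_iota.
Qed.

Lemma poly_ext (p q : {poly K}) : (forall x, p.[x] = q.[x]) -> p = q.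
Proof.
move=> h; apply/eqP; rewrite -subr_eq0; apply/eqP.
apply: (@poly_progression_eq0 _ 0 1); rewrite ?oner_neq0 // => n.
by rewrite hornerD hornerN h subrr.
Qed.

Lemma periodic_poly_const (p : {poly K}) h :
  h != 0 -> (forall x, p.[x + h] = p.[x]) -> p = p.[0]%:P.
Proof.
move=> h0 hp; apply/eqP; rewrite -subr_eq0; apply/eqP.
apply: (poly_progression_eq0 (x0 := 0) h0) => n.
rewrite hornerD hornerN hornerC; elim: n => [|n IHn].
  by rewrite mul0r addr0 subrr.
by rewrite -natr1 mulrDl mul1r addrA hp.
Qed.

Definition eval2 (f : {poly {poly K}}) (d l : K) : K := f.[l%:P].[d].

Lemma eval2_0 d l : eval2 0 d l = 0.
Proof. by rewrite /eval2 !horner0. Qed.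

Lemma eval2E f d l : eval2 f d l = (map_poly (horner_eval d) f).[l].
Proof.
rewrite /eval2 -[X in _ = _.[X]](hornerC l d).
by rewrite -[X in _ = _.[X]]/(horner_eval d l%:P) horner_map.
Qed.

Lemma eval2_ext (f g : {poly {poly K}}) :
  (forall d l, eval2 f d l = eval2 g d l) -> f = g.
Proof.
move=> h; apply/polyP => i; apply: poly_ext => d.
have : map_poly (horner_eval d) f = map_poly (horner_eval d) g.
  by apply: poly_ext => l; rewrite -!eval2E.
by move/polyP/(_ i); rewrite !coef_map.
Qed.

(** Every morphism to the constants that fixes them is an evaluation, so the
    substitutions occurring in the Jacobi identity need no computation of their
    own. *)
Lemma rmorph_eval2 (phi : {rmorphism {poly {poly K}} -> K}) f :
  (forall c, phi c%:P%:P = c) -> phi f = eval2 f (phi 'X%:P) (phi 'X).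
Proof.
move=> phiC; rewrite /eval2; elim/poly_ind: f => [|f q IHf].
  by rewrite rmorph0 !horner0.
rewrite rmorphD rmorphM /= IHf hornerMXaddC hornerD hornerM hornerC.
congr (_ + _); elim/poly_ind: q => [|q c IHq]; first by rewrite rmorph0 horner0.
by rewrite !rmorphD !rmorphM /= IHq hornerMXaddC phiC.
Qed.

(** The leading coefficient of [f] as a polynomial in the first variable is a
    nonzero polynomial [A(l)]; only finitely many [l] make [l A(l) A(-l)] vanish.
    Both signs are needed to read off the degree of [f(d, l) f(d + l, -l)]. *)
Lemma exists_generic_size (f : {poly {poly K}}) : f != 0 ->
  exists l, [/\ l != 0, size f.[l%:P] = sizeY f & size f.[(- l)%:P] = sizeY f].
Proof.
move=> f0; pose A := lead_coef (swapXY f).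
have A0 : A != 0 by rewrite lead_coef_eq0 swapXY_eq0.
have sz l : A.[l] != 0 -> size f.[l%:P] = sizeY f.
  by move=> Al; rewrite horner_polyC sizeYE; apply: size_map_poly_id0.
have B0 : 'X * A * (A \Po - 'X) != 0.
  rewrite !mulf_neq0 ?polyX_eq0 // -size_poly_eq0 size_comp_poly2 ?size_poly_eq0 //.
  by rewrite size_polyN size_polyX.
have [n hn] : exists n : nat, ('X * A * (A \Po - 'X)).[n%:R] != 0.
  apply: contrapT => hn; move/eqP: B0; apply.
  apply: (@poly_progression_eq0 _ 0 1); rewrite ?oner_neq0 // => n.
  rewrite add0r mulr1; apply/eqP; apply: contrapT => h.
  by apply: hn; exists n; apply/negP.
move: hn; rewrite !hornerM hornerX horner_comp hornerN hornerX !mulf_eq0.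
by rewrite !negb_or => /andP[/andP[h1 h2] h3]; exists n%:R; split=> //; apply: sz.
Qed.

Lemma size_shift_mul (p q : {poly K}) h : p != 0 -> q != 0 ->
  size (p * (q \Po ('X + h%:P))) = (size p + size q).-1.
Proof.
move=> p0 q0; have s2 : size ('X + h%:P) = 2 by rewrite size_XaddC.
by rewrite size_mul // -?size_poly_eq0 size_comp_poly2 ?size_poly_eq0.
Qed.

End PolynomialFunctions.

(** * Solving the equations of a rank one action *)

Section Actions.
Variable K : fieldType.
Hypothesis K0 : [pchar K] =i pred0.
Local Notation T1 := {poly {poly K}}.
Local Notation "f `( d , l )" := (eval2 f d l)
  (at level 9, d at level 100, l at level 100, format "f `( d ,  l )").

(** The value at [d], [l], [m] of [x_lambda (y_mu v) - y_mu (x_lambda v)], when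
    [x] and [y] act on the generator [v] by [f] and [g]. *)
Definition act_comm (f g : T1) (d l m : K) : K :=
  g`(d + l, m) * f`(d, l) - f`(d + m, l) * g`(d, m).

(** Reduces an equation that is a multiple of a known one to a ring identity. *)
Lemma eq_of_mul_sub (x y a b c : K) : a = b -> x - y = c * (a - b) -> x = y.
Proof.
by move=> -> /eqP; rewrite subrr mulr0 subr_eq0 => /eqP.
Qed.

Lemma two_neq0 : 2%:R != 0 :> K.
Proof. exact: natSf_neq0. Qed.

Lemma shifted_productE (f : T1) l x :
  (f.[l%:P] * (f.[(- l)%:P] \Po ('X + l%:P))).[x] = f`(x, l) * f`(x + l, - l).
Proof. by rewrite hornerM horner_comp hornerD hornerX hornerC. Qed.

(** At [m = - l] the commutator of an action with itself is a finite difference,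
    which determines the product [f(d, l) f(d + l, - l)] up to a constant. *)
Lemma act_comm_opp (f : T1) d l :
  act_comm f f d l (- l) =
  (f.[l%:P] * (f.[(- l)%:P] \Po ('X + l%:P))).[d]
  - (f.[l%:P] * (f.[(- l)%:P] \Po ('X + l%:P))).[d - l].
Proof. by rewrite !shifted_productE /act_comm subrK; ring. Qed.

(** By [act_comm_opp], the product [g(d, l) g(d + l, - l)] is periodic in [d], hence
    constant, so for generic [l] both factors have degree zero in [d]; the generic
    degree bounds all the others. *)
Lemma commuting_action_const (g : T1) :
  (forall d l m, act_comm g g d l m = 0) -> forall d l, g`(d, l) = g`(0, l).
Proof.
move=> hg; have [->|g0] := eqVneq g 0.
  by move=> d l; rewrite !eval2_0.
have [l0 [l0n s1 s2]] := exists_generic_size K0 g0.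
have sY0 : sizeY g != 0%N by rewrite sizeY_eq0.
pose U := g.[l0%:P] * (g.[(- l0)%:P] \Po ('X + l0%:P)).
have UC : U = U.[0]%:P.
  apply: (periodic_poly_const K0 l0n) => x.
  by apply/eqP; rewrite -subr_eq0 -{2}(addrK l0 x) -act_comm_opp hg.
have sU : size U = (sizeY g + sizeY g).-1.
  by rewrite /U size_shift_mul ?s1 ?s2 // -size_poly_eq0 ?s1 ?s2.
have sY1 : (sizeY g <= 1)%N.
  have : (size U <= 1)%N by rewrite UC size_polyC leq_b1.
  by rewrite sU; case: (sizeY g) sY0 => [//|[//|n _]]; rewrite addSn addnS.
move=> d l; rewrite /eval2.
by rewrite (size1_polyC (leq_trans (max_size_evalC g l) sY1)) !hornerC.
Qed.

(** The equation expresses that [d + h(l)] is a Virasoro action.  Taking [m = - l]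
    shows that [h - h(0)] is odd; the equations for [(1, m)] and [(1 + m, - m)] then
    combine to [2 h(1 + m) = 2 (h(1) - h(0)) (1 + m) + 2 h(0)]. *)
Lemma virasoro_weight (h : K -> K) :
  (forall l m, l * h l - m * h m = (l - m) * h (l + m)) ->
  forall l, h l = h 0 + (h 1 - h 0) * l.
Proof.
move=> hh; have odd m : m != 0 -> h (- m) = 2%:R * h 0 - h m.
  move=> m0; apply: (mulfI m0); apply: (eq_of_mul_sub (c := 1) (hh m (- m))).
  by rewrite subrr; ring.
move=> l; rewrite -(subrK 1 l); set m := l - 1.
have [->|m0] := eqVneq m 0; first by rewrite add0r; ring.
apply: (mulfI two_neq0); have e1 := hh 1 m; have e2 := hh (1 + m) (- m).
rewrite odd // addrK in e2; rewrite [m + 1]addrC.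
apply: (eq_of_mul_sub (c := 1) (congr2 (fun x y => y - x) e1 e2)).
ring.
Qed.

(** Classification of the rank one modules over the Virasoro conformal algebra.
    The case [l = 0] gives [f(d, 0) = d + beta], which makes the product
    [f(d, l) f(d + l, - l)] quadratic in [d]: hence [f(d, l) = A(l) d + h(l)] with
    [A(l) A(-l) = 1], so that the polynomial [A] is constant. *)
Lemma virasoro_rank_one (f : T1) :
  (forall d l m, act_comm f f d l m = (l - m) * f`(d, l + m)) ->
  f = 0 \/ exists alpha beta, forall d l, f`(d, l) = d + alpha * l + beta.
Proof.
move=> hf; have [->|f0] := eqVneq f 0; [by left|right].
have [l0 [l0n s1 s2]] := exists_generic_size K0 f0.
have sY0 : sizeY f != 0%N by rewrite sizeY_eq0.
pose beta := f`(0, 0).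
have fd0 d : f`(d, 0) = d + beta.
  (* The factor [f(d, l0)], nonzero as a polynomial in [d], cancels at l = 0. *)
  have shift : f.[0%:P] \Po ('X + l0%:P) = f.[0%:P] + l0%:P.
    have P0 : f.[l0%:P] != 0 by rewrite -size_poly_eq0 s1.
    apply: (mulfI P0); apply: (poly_ext K0) => x.
    have := hf x 0 l0; rewrite /act_comm addr0 !add0r => e.
    rewrite !hornerM horner_comp !hornerD hornerX hornerC.
    by apply: (eq_of_mul_sub (c := - 1) e); rewrite /eval2; ring.
  have : f.[0%:P] - 'X = (f.[0%:P] - 'X).[0]%:P.
    apply: (periodic_poly_const K0 l0n) => x.
    have := congr1 (fun p => p.[x]) shift; rewrite horner_comp.
    by rewrite !hornerD !hornerN !hornerX !hornerC => ->; ring.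
  move/eqP; rewrite subr_eq => /eqP fE.
  by rewrite {1}/eval2 fE !hornerE /beta /eval2; ring.
pose U l := f.[l%:P] * (f.[(- l)%:P] \Po ('X + l%:P)).
have UE l : l != 0 ->
    exists e, U l = 'X^2 + (2%:R * beta + l)%:P * 'X + e%:P.
  move=> l0'; exists (U l).[0].
  (* W is the quadratic polynomial with W(x + l) - W(x) = 2l (x + l + beta). *)
  pose W : {poly K} := 'X^2 + (2%:R * beta + l)%:P * 'X.
  have WE x : W.[x] = x ^+ 2 + (2%:R * beta + l) * x by rewrite /W !hornerE.
  have : U l - W = (U l - W).[0]%:P.
    apply: (periodic_poly_const K0 l0') => x.
    have := hf (x + l) l (- l); rewrite act_comm_opp addrK subrr fd0 -/(U l).
    rewrite !hornerD !hornerN !WE => e.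
    by apply: (eq_of_mul_sub (c := 1) e); ring.
  move/eqP; rewrite subr_eq addrC => /eqP {1}->.
  by rewrite hornerD hornerN WE mulr0 expr0n addr0 subr0.
have sY2 : sizeY f = 2.
  have [e Ue] := UE _ l0n.
  have : size (U l0) = (sizeY f + sizeY f).-1.
    by rewrite /U size_shift_mul ?s1 ?s2 // -size_poly_eq0 ?s1 ?s2.
  rewrite Ue -addrA size_polyDl ?size_polyXn; last first.
    by rewrite ltnS size_MXaddC; case: ifP => // _; rewrite ltnS size_polyC leq_b1.
  by case: (sizeY f) => [|[|[|n]]] //; rewrite !addSn !addnS.
pose A := (swapXY f)`_1; pose h l := f`(0, l).
have fE d l : f`(d, l) = A.[l] * d + h l.
  have := max_size_evalC f l; rewrite sY2 => sl.
  rewrite /h /eval2 !(horner_coef_wide _ sl) !big_ord_recl !big_ord0 /=.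
  by rewrite !expr0 expr0n horner_polyC !coef_map /= /horner_eval expr1; ring.
have A1 : A = 1.
  have AA : A * (A \Po - 'X) = 1.
    apply/eqP; rewrite -subr_eq0; apply/eqP.
    apply: (@poly_progression_eq0 _ K0 _ 1 1); rewrite ?oner_neq0 // => n.
    rewrite mulr1 -mulrS; set l : K := n.+1%:R.
    have [e Ue] := UE l (natSf_neq0 K0 n).
    (* The leading coefficient [A(l) A(-l)] is half of a second difference of U. *)
    have UV x := congr1 (fun p => p.[x]) Ue.
    move: (UV 0) (UV 1) (UV (-1)); rewrite !shifted_productE !fE.
    rewrite !(hornerD, hornerM, horner_comp, hornerN, hornerX, hornerXn, hornerC).
    move=> u0 u1 u2.
    apply: (mulfI two_neq0).
    apply: (eq_of_mul_sub (c := 1)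
      (congr2 +%R (congr2 +%R u1 u2) (congr1 (fun z => - (2%:R * z)) u0))).
    ring.
  have : A \is a GRing.unit by apply/unitrPr; exists (A \Po - 'X).
  rewrite poly_unitE => /andP[/size_poly1P[c c0 Ac] _].
  have := fd0 1; rewrite -[beta]add0r -(fd0 0) !fE Ac !hornerC => e.
  by rewrite -polyC1; congr _%:P; apply: (eq_of_mul_sub (c := 1) e); ring.
exists (h 1 - h 0), (h 0) => d l.
have hh : forall l m, l * h l - m * h m = (l - m) * h (l + m).
  move=> l' m; have := hf 0 l' m; rewrite /act_comm !fE A1 !hornerE => e.
  by apply: (eq_of_mul_sub (c := 1) e); ring.
by rewrite fE A1 hornerC mul1r (virasoro_weight hh); ring.
Qed.

(** At [l = m] the equation says that [g(d, m) / (d + alpha m + beta)] does not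
    change when [d] moves by [m], so it is a constant [C(m)] for [m != 0].  The
    general equation then propagates [C(m)] from [m] to [l + m]. *)
Lemma virasoro_intertwiner (f g : T1) alpha beta :
  (forall d l, f`(d, l) = d + alpha * l + beta) ->
  (forall d l m, act_comm f g d l m = (l - m) * g`(d, l + m)) ->
  forall d l, g`(d, l) = g`(1 - beta, 0) * (d + alpha * l + beta).
Proof.
(* C m is the ratio g / f at the point where f(d, m) = m. *)
move=> fE hg; pose C m := g`(m - alpha * m - beta, m) / m.
have gC m : m != 0 -> forall d, g`(d, m) = C m * (d + alpha * m + beta).
  (* x 0 is the zero of d + alpha m + beta; the equation steps from x n to x (n + 1). *)
  move=> m0 d; pose x n := - alpha * m - beta + n%:R * m.
  have step n : g`(x n.+1, m) * (n%:R * m) = n.+1%:R * m * g`(x n, m).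
    have := hg (x n) m m; rewrite /act_comm subrr mul0r !fE => e.
    have -> : x n.+1 = x n + m by rewrite /x -natr1; ring.
    by apply: (eq_of_mul_sub (c := 1) e); rewrite /x -[n.+1%:R]natr1; ring.
  have x0 : g`(x 0%N, m) = 0.
    have := step 0%N; rewrite mul0r mulr0 mul1r => /esym/eqP.
    by rewrite mulf_eq0 (negPf m0) => /eqP.
  have xn n : g`(x n, m) = n%:R * g`(x 1%N, m).
    elim: n => [|[|n] IHn]; rewrite ?mul0r ?mul1r //.
    have nm := mulf_neq0 (natSf_neq0 K0 n) m0. apply: (mulIf nm). rewrite step IHn; ring.
  have Cx : g`(x 1%N, m) = C m * m.
    by rewrite /C mulfVK //; congr eval2; rewrite /x mul1r; ring.
  have : g.[m%:P] - (C m)%:P * ('X + (alpha * m + beta)%:P) = 0.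
    apply: (poly_progression_eq0 K0 (x0 := - alpha * m - beta) m0) => n.
    rewrite !(hornerD, hornerN, hornerM, hornerX, hornerC).
    rewrite -/(x n) -[_.[x n]]/(g`(x n, m)) xn Cx /x; ring.
  move/eqP; rewrite subr_eq0 => /eqP gm.
  by rewrite /eval2 gm !(hornerD, hornerM, hornerX, hornerC) addrA.
have gS d l m : m != 0 -> l != m -> g`(d, l + m) = C m * (d + alpha * (l + m) + beta).
  move=> m0 lm; have lm0 : l - m != 0 by rewrite subr_eq0.
  apply: (mulfI lm0); rewrite -hg /act_comm !gC // !fE; ring.
have n1 : 1 != 0 :> K by exact: oner_neq0.
have gE d n : g`(d, n) = C 1 * (d + alpha * n + beta).
  have [n2|n2] := eqVneq n 2%:R; last first.
    have -> : n = (n - 1) + 1 by ring.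
    by apply: gS => //; apply: contra n2 => /eqP h; rewrite -[n](subrK 1) h.
  (* From m = 1 the value 2 is the exception [l = m]; it is reached from m = -1. *)
  have nN1 : -1 != 0 :> K by rewrite oppr_eq0.
  have CN1 : C (-1) = C 1.
    (* At this point d + alpha (-1) + beta = 1. *)
    have -> : C 1 = g`(1 + alpha - beta, -2%:R + 1).
      rewrite gS //; first by ring.
      by rewrite -subr_eq0 -opprD oppr_eq0 natr1 natSf_neq0.
    have -> : -2%:R + 1 = -1 :> K by ring.
    by rewrite gC //; ring.
  have -> : n = 3%:R + -1 by rewrite n2; ring.
  rewrite -CN1; apply: gS => //.
  by rewrite -subr_eq0 opprK natr1 natSf_neq0.
by move=> d l; rewrite !gE; ring.
Qed.

Section LoopAction.
Variables (a b : K) (L M : int -> T1).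
Hypothesis LL : forall i j d l m,
  act_comm (L i) (L j) d l m = (l - m) * (L (i + j))`(d, l + m).
Hypothesis LM : forall i j d l m,
  act_comm (L i) (M j) d l m = ((a - 1) * l - m + b) * (M (i + j))`(d, l + m).
Hypothesis MM : forall i j d l m, act_comm (M i) (M j) d l m = 0.

Lemma loop_L : exists alpha beta c, forall i d l,
  (L i)`(d, l) = cpow c i * (d + alpha * l + beta).
Proof.
have [L0|[alpha [beta L0]]] := virasoro_rank_one (LL 0 0).
  exists 0, 0, 0 => j d l; rewrite /cpow eqxx mul0r.
  (* These two points have difference 1 and sum l. *)
  have := LL 0 j d ((l + 1) / 2%:R) ((l - 1) / 2%:R).
  rewrite /act_comm L0 add0r !eval2_0 mulr0 mul0r subrr.
  have -> : (l + 1) / 2%:R - (l - 1) / 2%:R = 1 by field; exact: two_neq0.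
  have -> : (l + 1) / 2%:R + (l - 1) / 2%:R = l by field; exact: two_neq0.
  by rewrite mul1r.
pose A j := (L j)`(1 - beta, 0).
have LA j d l : (L j)`(d, l) = A j * (d + alpha * l + beta).
  apply: (virasoro_intertwiner L0) => d' l' m; by rewrite LL add0r.
have AD i j : A (i + j) = A i * A j.
  (* A point where (l - m) (d + alpha (l + m) + beta) is 1. *)
  have := LL i j (1 - alpha - beta) 1 0; rewrite /act_comm !LA => e.
  by apply: (eq_of_mul_sub (c := - 1) e); ring.
have A0 : A 0 = 1 by rewrite /A L0; ring.
have A1 : A 1 != 0.
  apply/negP => /eqP h; have := AD 1 (-1).
  by rewrite subrr A0 h mul0r => /eqP; rewrite oner_eq0.
exists alpha, beta, (A 1) => j d l; rewrite LA; congr (_ * _).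
rewrite /cpow (negPf A1).
elim: j => [|n IHn|n IHn]; first by rewrite A0 expr0z.
  by rewrite -[in LHS]addn1 PoszD AD IHn exprSzr.
apply: (mulIf A1); rewrite -AD -[X in _ = _ * X]expr1z -expfzDr //.
by rewrite -addn1 PoszD opprD -addrA addNr addr0.
Qed.

Lemma loop_M_const i d l : (M i)`(d, l) = (M i)`(0, l).
Proof. by apply: commuting_action_const => d' l' m; exact: MM. Qed.

(** As [M_i] does not involve [d], the commutator with [L_0] vanishes at [m = 0]
    and leaves [((a - 1) l + b) M_i(l) = 0]. *)
Lemma loop_M_eq0 i : a <> 1 \/ b <> 0 -> M i = 0.
Proof.
move=> ab; apply: (eval2_ext K0) => d l; rewrite loop_M_const eval2_0.
have [alpha [beta [c LE]]] := loop_L.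
pose p := map_poly (horner_eval 0) (M i).
have : ((a - 1)%:P * 'X + b%:P) * p = 0.
  apply: (poly_ext K0) => x; rewrite horner0 hornerM -eval2E.
  rewrite !(hornerD, hornerM, hornerX, hornerC).
  have := LM 0 i 0 x 0; rewrite /act_comm !LE !addr0 !add0r (loop_M_const i x) => e.
  by apply: (eq_of_mul_sub (c := - 1) e); ring.
move/eqP; rewrite mulf_eq0 => /orP[/eqP h|/eqP h]; last first.
  by rewrite eval2E -/p h horner0.
have h0 := congr1 (fun p => p.[0]) h; have h1 := congr1 (fun p => p.[1]) h.
rewrite !(hornerD, hornerM, hornerX, hornerC) mulr0 add0r in h0.
rewrite !(hornerD, hornerM, hornerX, hornerC) mulr1 h0 addr0 in h1.
by case: ab => []; [move/eqP: h1; rewrite subr_eq0 => /eqP|].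
Qed.

End LoopAction.

Lemma loop_M (L M : int -> T1) alpha beta c :
  (forall i d l, (L i)`(d, l) = cpow c i * (d + alpha * l + beta)) ->
  (forall i j d l m,
     act_comm (L i) (M j) d l m = - m * (M (i + j))`(d, l + m)) ->
  (forall i j d l m, act_comm (M i) (M j) d l m = 0) ->
  exists e, forall i d l, (M i)`(d, l) = e * cpow c i.
Proof.
move=> LE LM MM; have Mc := loop_M_const MM; exists ((M 0)`(0, 1)) => i d l.
have := LM i 0 0 (l - 1) 1; rewrite /act_comm !LE addr0 subrK.
rewrite (Mc 0 (0 + _)) (Mc i d) => e.
by apply: (eq_of_mul_sub (c := 1) e); ring.
Qed.

End Actions.

(** * From modules to polynomials *)

Section Coordinates.
Variable K : fieldType.
Local Notation T1 := {poly {poly K}}.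

Definition free_generator (V : lmodType {poly K}) (v : V) := forall w, exists! p : {poly K}, w = p *: v.

Lemma free_generator_inj (V : lmodType {poly K}) (v : V) : free_generator v -> injective (fun p => p *: v).
Proof.
by move=> hv p q e; have [r [_ ru]] := hv (p *: v); rewrite -(ru p) // (ru q).
Qed.

Lemma lcoef_scale_const (S : comNzRingType) (W : lmodType S) (f : {poly S}) (w : W) n :
  lcoef n (f *: lconst w) = f`_n *: w.
Proof.
rewrite lcoefZ (bigD1 ord_max) //= subnn {1}/lcoef mcoeffUU big1 ?addr0 // => i ni.
rewrite /lcoef mcoeffU; case: eqP => [e|_]; last by rewrite mulr0n scaler0.
by move: ni; rewrite -val_eqE /= eqn_leq leq_ord /= -subn_eq0 -e eqxx.
Qed.

Lemma scale_const_inj (S : comNzRingType) (W : lmodType S) (w : W) :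
  injective (fun p : S => p *: w) -> injective (fun f : {poly S} => f *: lconst w).
Proof.
move=> hw f g e; apply/polyP => n; apply: hw.
by rewrite -!lcoef_scale_const e.
Qed.

Lemma exists_coordinate (V : lmodType {poly K}) (v : V) (f : lampoly V) :
  free_generator v -> exists p : T1, f = p *: lconst v.
Proof.
move=> hv; have [n /(_ n (leqnn _)) fn] := lbound f.
have coord k : exists p, lcoef k f = p *: v.
  by have [p [e _]] := hv (lcoef k f); exists p.
have [c cE] := choice coord; exists (\poly_(k < n) c k).
apply: lcoefP => k; rewrite lcoef_scale_const coef_poly.
by case: ltnP => [_|/fn ->]; rewrite ?cE // scale0r.
Qed.

Lemma coordinate_iso (V W : lmodType {poly K}) (v : V) (w : W) :
  free_generator v -> free_generator w ->
  exists f : {linear V -> W}, bijective f /\ f v = w.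
Proof.
move=> hv hw.
have cv x : exists p, x = p *: v by have [p [e _]] := hv x; exists p.
have cw y : exists p, y = p *: w by have [p [e _]] := hw y; exists p.
have [[g gE] [h hE]] := (choice cv, choice cw).
have iv := free_generator_inj hv; have iw := free_generator_inj hw.
have gZ p : g (p *: v) = p by apply: iv; rewrite -gE.
have f_linear : linear (fun x => g x *: w).
  move=> p x y; rewrite scalerA -scalerDl; congr (_ *: _); apply: iv.
  by rewrite -gE scalerDl -scalerA -!gE.
pose f : {linear V -> W} :=
  HB.pack (fun x => g x *: w) (GRing.isLinear.Build _ _ _ _ _ f_linear).
exists f; split; last by rewrite /= -[v]scale1r gZ scale1r.
exists (fun y => h y *: v) => x /=; last by rewrite gZ -hE.
by rewrite [RHS]gE; congr (_ *: _); apply: iw; rewrite -hE.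
Qed.
End Coordinates.

Section Evaluation.
Variable K : fieldType.
Local Notation T1 := {poly {poly K}}.
Local Notation T2 := {poly {poly {poly K}}}.

Definition eval3 (d l m : K) : T2 -> K :=
  horner_eval d \o (horner_eval l%:P \o horner_eval m%:P%:P).
HB.instance Definition _ d l m := GRing.RMorphism.on (eval3 d l m).

Lemma eval3C d l m c : eval3 d l m c%:P%:P%:P = c.
Proof. by rewrite /eval3 /= /horner_eval !hornerC. Qed.
Lemma eval3_del d l m : eval3 d l m (del2 K) = d.
Proof. by rewrite /eval3 /= /horner_eval !(hornerC, hornerX). Qed.
Lemma eval3_lam d l m : eval3 d l m (lam2 K) = l.
Proof. by rewrite /eval3 /= /horner_eval !(hornerC, hornerX). Qed.
Lemma eval3_mu d l m : eval3 d l m (mu2 K) = m.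
Proof. by rewrite /eval3 /= /horner_eval !(hornerC, hornerX). Qed.

Lemma eval3_subst (phi : {rmorphism {poly K} -> T2}) d l m (t : T2) (f : T1) :
  (forall c, phi c%:P = c%:P%:P%:P) ->
  eval3 d l m (map_poly phi f).[t]
  = eval2 f (eval3 d l m (phi 'X)) (eval3 d l m t).
Proof.
move=> phiC.
rewrite -[LHS]/((eval3 d l m \o (horner_eval t \o map_poly phi)) f).
rewrite rmorph_eval2 /= => [|c].
  by rewrite map_polyC map_polyX /horner_eval hornerC hornerX.
by rewrite map_polyC /horner_eval hornerC /= phiC eval3C.
Qed.

Lemma eval3_psub2 d l m s t (f : T1) :
  eval3 d l m (map_poly (psub2 s) f).[t]
  = eval2 f (eval3 d l m s) (eval3 d l m t).
Proof. by rewrite eval3_subst /= ?psub2X // => c; rewrite psub2C. Qed.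

Lemma eval3_cc2 d l m t (f : T1) :
  eval3 d l m (map_poly (@cc2 K) f).[t] = eval2 f d (eval3 d l m t).
Proof.
by rewrite eval3_subst //; congr eval2; exact: eval3_del.
Qed.

(** Since [v] is free, both sides of the Jacobi identity have unique coefficients
    along [v], which may be evaluated at any point. *)
Lemma jacobi_eval (R V : lmodType {poly K}) (act : R -> V -> lampoly V)
    (br : R -> R -> lampoly R) x y z v (f g p h : T1) :
  sesquilinear act -> injective (fun q : {poly K} => q *: v) ->
  br x y = p *: lconst z -> act x v = f *: lconst v ->
  act y v = g *: lconst v -> act z v = h *: lconst v ->
  jacobi br act x y v -> forall d l m,
  act_comm f g d l m = eval2 p (- (l + m)) l * eval2 h d (l + m).
Proof.
move=> ses iv e1 ex ey ez; rewrite /jacobi e1 ex ey.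
rewrite !(lsubst_actrE ses) (lsubst_actlE ses) /act_at ex ey ez !lsubst_ccE.
rewrite !scalerA -scalerBl => /(scale_const_inj (scale_const_inj iv)) e d l m.
have := congr1 (eval3 d l m) e; rewrite rmorphB !rmorphM /=.
rewrite !eval3_psub2 !eval3_cc2 !(rmorphD, rmorphN) /=.
by rewrite !(eval3_del, eval3_lam, eval3_mu).
Qed.

End Evaluation.

Lemma rk1_gen_free (K : fieldType) : free_generator (@rk1_gen K).
Proof.
move=> p; exists p; split=> [|q ->]; last by rewrite [LHS]mulr1.
by rewrite [RHS]mulr1.
Qed.

Section Classification.
Variables (K : fieldType) (a b : K).
Local Notation T1 := {poly {poly K}}.

(** The identification of the generators extends to a linear bijection; by
    sesquilinearity, the actions agree as soon as the basis elements act on the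
    generators by the same polynomials. *)
Lemma cm_iso_of_generators (V W : confModule (CHV a b)) (v : V) (w : W) :
  free_generator v -> free_generator w ->
  (forall k, exists F : T1,
     cm_act (mkmalgU k 1 : CHV a b) v = F *: lconst v
     /\ cm_act (mkmalgU k 1 : CHV a b) w = F *: lconst w) ->
  cm_iso V W.
Proof.
move=> hv hw gen; have [f [f_bij fv]] := coordinate_iso hv hw.
exists f; split=> // x u n.
have {gen} [F [Fv Fw]] : exists F : T1,
    cm_act x v = F *: lconst v /\ cm_act x w = F *: lconst w.
  have [sv sw] := (cm_sesquilinear V, cm_sesquilinear W).
  elim/malg_span: x => [|x y [F [Fv Fw]] [G [Gv Gw]]|p x [F [Fv Fw]]|//].
  - by exists 0; rewrite !scale0r (sesq0l sv) (sesq0l sw).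
  - by exists (F + G); rewrite (sesqDl sv) (sesqDl sw) Fv Fw Gv Gw !scalerDl.
  - exists (psub1 (- 'X) p * F).
    by rewrite (sesqZl sv) (sesqZl sw) Fv Fw !scalerA.
have [p [-> _]] := hv u; rewrite linearZ fv /=.
rewrite (sesqZr (cm_sesquilinear V)) (sesqZr (cm_sesquilinear W)) Fv Fw.
by rewrite !scalerA !lcoef_scale_const linearZ fv.
Qed.

Lemma rank_one_action (V : confModule (CHV a b)) (v : V) :
  free_generator v ->
  exists L M : int -> T1,
  [/\ forall i, cm_act (chvL K i : CHV a b) v = L i *: lconst v,
      forall i, cm_act (chvM K i : CHV a b) v = M i *: lconst v,
      forall i j d l m,
        act_comm (L i) (L j) d l m = (l - m) * eval2 (L (i + j)) d (l + m),
      forall i j d l m, act_comm (L i) (M j) d l m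
        = ((a - 1) * l - m + b) * eval2 (M (i + j)) d (l + m)
    & forall i j d l m, act_comm (M i) (M j) d l m = 0].
Proof.
move=> hv.
have [L LE] := choice (fun i => exists_coordinate (cm_act (chvL K i : CHV a b) v) hv).
have [M ME] := choice (fun i => exists_coordinate (cm_act (chvM K i : CHV a b) v) hv).
have sV := cm_sesquilinear V; have iv := free_generator_inj hv.
have J x y := @cm_jacobi _ _ V x y v.
have br k l := chv_brE a b k l.
exists L, M; split=> // i j d l m.
- rewrite (jacobi_eval sV iv (br (inl i) (inl j)) (LE i) (LE j) (LE (i + j)) (J _ _)).
  by rewrite {1}/eval2 !(hornerD, hornerMn, hornerC, hornerX); congr (_ * _); ring.
- rewrite (jacobi_eval sV iv (br (inl i) (inr j)) (LE i) (ME j) (ME (i + j)) (J _ _)).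
  by rewrite {1}/eval2 !(hornerD, hornerM, hornerC, hornerX); congr (_ * _); ring.
have br0 : chv_br a b (chvM K i) (chvM K j) = 0 *: lconst (chvM K (i + j)).
  by rewrite scale0r; exact: (br (inr i) (inr j)).
rewrite (jacobi_eval sV iv br0 (ME i) (ME j) (ME (i + j)) (J _ _)).
by rewrite eval2_0 mul0r.
Qed.

Lemma virasoro_part_eval (alpha beta c d l : K) i :
  eval2 ((cpow c i)%:P%:P * ('X%:P + alpha%:P%:P * 'X + beta%:P%:P)) d l
  = cpow c i * (d + alpha * l + beta).
Proof. by rewrite /eval2 !hornerE. Qed.

Hypothesis K0 : [pchar K] =i pred0.

Lemma rank_one_Mabc (V : confModule (CHV a b)) :
  free_rank_one V -> a <> 1 \/ b <> 0 ->
  exists alpha beta c, cm_iso V (Mabc a b alpha beta c).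
Proof.
case=> v hv ab; have [L [M [LE ME LL LM MM]]] := rank_one_action hv.
have [alpha [beta [c Lc]]] := loop_L K0 LL; exists alpha, beta, c.
refine (cm_iso_of_generators (W := Mabc a b alpha beta c) hv (@rk1_gen_free K) _) => k.
exists (am3 alpha beta c k); split; last exact: rk1_actE.
case: k => i.
  rewrite [LHS]LE; congr (_ *: _); apply: (eval2_ext K0) => d l.
  by rewrite Lc virasoro_part_eval.
by rewrite [LHS]ME (loop_M_eq0 K0 LL LM MM).
Qed.

End Classification.

Lemma rank_one_Mabcd (K : fieldType) (V : confModule (CHV (1 : K) 0)) :
  [pchar K] =i pred0 -> free_rank_one V ->
  exists alpha beta c d, cm_iso V (Mabcd alpha beta c d).
Proof.
move=> K0 [v hv]; have [L [M [LE ME LL LM MM]]] := rank_one_action hv.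
have [alpha [beta [c Lc]]] := loop_L K0 LL.
have LM' i j d l m :
    act_comm (L i) (M j) d l m = - m * eval2 (M (i + j)) d (l + m).
  by rewrite LM subrr mul0r add0r addr0.
have [e Me] := loop_M K0 Lc LM' MM; exists alpha, beta, c, e.
refine (cm_iso_of_generators (W := Mabcd alpha beta c e) hv (@rk1_gen_free K) _) => k.
exists (am4 alpha beta c e k); split; last exact: rk1_actE.
case: k => i.
  rewrite [LHS]LE; congr (_ *: _); apply: (eval2_ext K0) => d l.
  by rewrite Lc virasoro_part_eval.
rewrite [LHS]ME; congr (_ *: _); apply: (eval2_ext K0) => d l.
by rewrite Me /eval2 !hornerC.
Qed.

(** * Irreducibility *)

Section Irreducibility.
Variables (K : fieldType) (a b : K).
Local Notation T1 := {poly {poly K}}.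

Lemma psub1_shiftE (p : {poly K}) : psub1 ('X%:P + 'X) p = poly_XaY p.
Proof.
rewrite /poly_XaY addrC; elim/poly_ind: p => [|p c IHp].
  by rewrite !rmorph0.
rewrite !rmorphD !rmorphM /= IHp psub1X psub1C map_polyX map_polyC /=.
by rewrite comp_polyX comp_polyC.
Qed.

(** If a submodule contains [p(d) v], it contains the top coefficient in [lambda]
    of [p(d + lambda) F(d, lambda) v], which is the nonzero scalar multiple
    [lead_coef p * e] of [v]. *)
Lemma irreducible_of_lead_coef (V : confModule (CHV a b)) (v : V) k F (e : K) :
  free_generator v ->
  cm_act (mkmalgU k 1 : CHV a b) v = F *: lconst v ->
  lead_coef F = e%:P -> e != 0 -> irreducible V.
Proof.
move=> hv actv Fe e0; have iv := free_generator_inj hv.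
split.
  exists v => v0; have /eqP : (1 : {poly K}) = 0 by apply: iv; rewrite v0 !scaler0.
  by rewrite oner_eq0.
move=> N [N0 ND NZ Nact].
have [[u [Nu u0]]|noN] := EM (exists u, N u /\ u <> 0); last first.
  by left => u Nu; apply: contrapT => u0; apply: noN; exists u.
right; have [p [up _]] := hv u.
have p0 : p != 0 by apply/eqP => p0; apply: u0; rewrite up p0 scale0r.
pose G := poly_XaY p * F.
have actu : cm_act (mkmalgU k 1 : CHV a b) u = G *: lconst v.
  by rewrite up (sesqZr (cm_sesquilinear V)) actv scalerA psub1_shiftE.
have Nw : N ((lead_coef p * e)%:P *: v).
  have := Nact (mkmalgU k 1 : CHV a b) u (size G).-1 Nu.
  rewrite actu lcoef_scale_const -lead_coefE lead_coefM lead_coef_poly_XaY Fe.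
  by rewrite -polyCM.
have Nv : N v.
  have le0 : lead_coef p * e != 0 by rewrite mulf_neq0 ?lead_coef_eq0.
  by have := NZ (lead_coef p * e)^-1%:P _ Nw; rewrite scalerA -polyCM mulVf ?scale1r.
by move=> w; have [q [-> _]] := hv w; apply: NZ.
Qed.

(** The multiples of [q(d) v] contain every product [x_lambda v], hence form a
    submodule; it is nonzero as [q] is, and proper as [q] is not a unit. *)
Lemma reducible_of_common_factor (V : confModule (CHV a b)) (v : V) (q : {poly K}) :
  free_generator v -> (1 < size q)%N ->
  (forall k, exists G : T1,
     cm_act (mkmalgU k 1 : CHV a b) v = (q%:P * G) *: lconst v) ->
  ~ irreducible V.
Proof.
move=> hv sq gen [_ irr]; have iv := free_generator_inj hv.
have sV := cm_sesquilinear V.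
have actv x : exists G : T1, cm_act x v = (q%:P * G) *: lconst v.
  elim/malg_span: x => [|x y [F Fv] [G Gv]|p x [F Fv]|//].
  - by exists 0; rewrite mulr0 scale0r (sesq0l sV).
  - by exists (F + G); rewrite (sesqDl sV) Fv Gv mulrDr scalerDl.
  - exists (psub1 (- 'X) p * F).
    by rewrite (sesqZl sV) Fv scalerA mulrCA.
case: (irr (fun u => exists r, u = (q * r) *: v)).
- split.
  + by exists 0; rewrite mulr0 scale0r.
  + by move=> _ _ [r ->] [s ->]; exists (r + s); rewrite mulrDr scalerDl.
  + by move=> p _ [r ->]; exists (p * r); rewrite scalerA mulrCA.
  move=> x _ n [r ->]; have [G Gv] := actv x.
  exists (psub1 ('X%:P + 'X) (q * r) * G)`_n.
  by rewrite (sesqZr sV) Gv scalerA mulrCA lcoef_scale_const coefCM.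
- move=> all0; have q0 : q = 0.
    by apply: iv; rewrite scale0r; apply: all0; exists 1; rewrite mulr1.
  by rewrite q0 size_poly0 in sq.
move=> allN; have [r vr] := allN v.
have q1 : q * r = 1 by apply: iv; rewrite -vr scale1r.
have : q \is a GRing.unit by apply/unitrPr; exists r.
by rewrite poly_unitE => /andP[/eqP sq1 _]; rewrite sq1 in sq.
Qed.

End Irreducibility.

Section IrreducibleRankOne.
Variable K : fieldType.

Lemma virasoro_part_lead_coef (alpha beta c : K) : c != 0 -> alpha != 0 ->
  lead_coef ((cpow c 0)%:P%:P * ('X%:P + alpha%:P%:P * 'X + beta%:P%:P)) = alpha%:P.
Proof.
move=> c0 al0; rewrite /cpow (negPf c0) expr0z mul1r addrAC -polyCD addrC.
rewrite lead_coefDl ?lead_coefM ?lead_coefC ?lead_coefX ?mulr1 //.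
rewrite size_mulX ?polyC_eq0 // !size_polyC polyC_eq0 al0.
by case: (_ != 0).
Qed.

Lemma irreducible_Mabc (a b alpha beta c : K) :
  irreducible (Mabc a b alpha beta c) <-> alpha <> 0 /\ c <> 0.
Proof.
have gen k := rk1_actE (am3 alpha beta c) k.
split=> [irr|[/eqP al0 /eqP c0]]; last first.
  apply: (irreducible_of_lead_coef (V := Mabc a b alpha beta c)
    (@rk1_gen_free K) (gen (inl 0)) _ al0).
  exact: virasoro_part_lead_coef.
split=> e0; move: irr;
  apply: (reducible_of_common_factor (V := Mabc a b alpha beta c)
    (q := 'X + beta%:P) (@rk1_gen_free K)); rewrite ?size_XaddC // => k.
- exists (if k is inl i then (cpow c i)%:P%:P else 0).
  rewrite [LHS]gen; congr (_ *: _); case: k => i /=; last by rewrite mulr0.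
  by rewrite e0 !polyC0 mul0r addr0 polyCD mulrC.
exists 0; rewrite [LHS]gen; congr (_ *: _); rewrite mulr0.
by case: k => i //=; rewrite /cpow e0 eqxx !polyC0 mul0r.
Qed.

Lemma irreducible_Mabcd (alpha beta c d : K) :
  irreducible (Mabcd alpha beta c d) <-> c <> 0 /\ (alpha <> 0 \/ d <> 0).
Proof.
have gen k := rk1_actE (am4 alpha beta c d) k.
split=> [irr|[/eqP c0 [/eqP al0|/eqP d0]]]; last first.
- have c1 : cpow c 0 = 1 by rewrite /cpow (negPf c0) expr0z.
  apply: (irreducible_of_lead_coef (V := Mabcd alpha beta c d)
    (@rk1_gen_free K) (gen (inr 0)) _ d0).
  by rewrite lead_coefC c1 mulr1.
- apply: (irreducible_of_lead_coef (V := Mabcd alpha beta c d)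
    (@rk1_gen_free K) (gen (inl 0)) _ al0).
  exact: virasoro_part_lead_coef.
split=> [e0|].
  move: irr; apply: (reducible_of_common_factor (V := Mabcd alpha beta c d)
    (q := 'X) (@rk1_gen_free K)); rewrite ?size_polyX // => k.
  exists 0; rewrite [LHS]gen; congr (_ *: _); rewrite mulr0.
  by case: k => i //=; rewrite /cpow e0 eqxx ?mulr0 !polyC0 ?mul0r.
apply: contrapT => /not_orP[/contrapT e0 /contrapT d0].
move: irr; apply: (reducible_of_common_factor (V := Mabcd alpha beta c d)
    (q := 'X + beta%:P) (@rk1_gen_free K)); rewrite ?size_XaddC // => k.
exists (if k is inl i then (cpow c i)%:P%:P else 0).
rewrite [LHS]gen; congr (_ *: _); case: k => i /=.
  by rewrite e0 !polyC0 mul0r addr0 polyCD mulrC.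
by rewrite d0 mul0r !polyC0 mulr0.
Qed.

End IrreducibleRankOne.


Theorem theorem6p2 (R : realType) :
  [/\ forall (a b : R[i]) (M : confModule (CHV a b)),
        free_rank_one M -> a <> 1%R \/ b <> 0%R ->
        exists alpha beta c : R[i], cm_iso M (Mabc a b alpha beta c),
      forall M : confModule (CHV (1%R : R[i]) 0%R),
        free_rank_one M ->
        exists alpha beta c d : R[i], cm_iso M (Mabcd alpha beta c d),
      forall a b alpha beta c : R[i],
        irreducible (Mabc a b alpha beta c) <-> alpha <> 0%R /\ c <> 0%R
    & forall alpha beta c d : R[i],
        (irreducible (Mabc 1%R 0%R alpha beta c) /\
         irreducible (Mabcd alpha beta c d) <-> alpha <> 0%R /\ c <> 0%R)
        /\
        (irreducible (Mabcd alpha beta c d) <->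
           c <> 0%R /\ (alpha <> 0%R \/ d <> 0%R)) ].
Proof.
have K0 : [pchar R[i]] =i pred0 by apply: Num.Theory.pchar_num.
split.
- by move=> a b V; exact: rank_one_Mabc.
- by move=> V; exact: rank_one_Mabcd.
- by move=> a b alpha beta c; exact: irreducible_Mabc.
move=> alpha beta c d; have [h1 h2] := irreducible_Mabc 1 0 alpha beta c.
have irr4 := irreducible_Mabcd alpha beta c d; split=> //; split=> [[]|[al0 c0]].
  by move=> irr3 _; exact: h1.
by split; [exact: h2|apply/irr4; split=> //; left].
Qed.
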